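(* Let $k$ be a field and let $\mathbf{QSh}^d_+$ be the vector space with basis the nonempty decorated packed words, endowed with its NQSh products $\prec,\succ,\bullet$. Put $\preceq\,:=\,\prec+\bullet$ and $\succeq\,:=\,\succ+\bullet$. Then $(\mathbf{QSh}^d_+,\preceq,\succ)$ and $(\mathbf{QSh}^d_+,\prec,\succeq)$ are free noncommutative shuffle (NSh, i.e. dendriform) algebras.
   Context: A packed word of length $n$ is a word $\sigma=\sigma(1)\cdots\sigma(n)$ of positive integers whose set of letters is $\{1,\dots,m\}$ for some $m$. For any word $u$ of positive integers, $Pack(u)$ is the unique packed word of the same length with letters in the same relative order (including equalities). A decorated packed word of length $n$ is a pair $(\sigma,d)$ with $\sigma$ a packed word of length $n$ and $d:\{1,\dots,n\}\to\mathbb N^*$ any map. Products: for $(\sigma,d)$ of length $p\ge1$ and $(\tau,e)$ of length $l\ge1$, $(\sigma,d)\prec(\tau,e)$ (resp. $\succ$, $\bullet$) is the sum of all decorated packed words $(u,de)$, where $de=(d(1),\dots,d(p),e(1),\dots,e(l))$ and $u=u(1)\cdots u(p+l)$ runs over packed words such that $Pack(u(1)\cdots u(p))=\sigma$, $Pack(u(p+1)\cdots u(p+l))=\tau$ and $\min(u(1),\dots,u(p))<\min(u(p+1),\dots,u(p+l))$ (resp. $>$, resp. $=$). A noncommutative shuffle (NSh, dendriform) algebra is a vector space with two bilinear products $\prec,\succ$ such that, with $x\star y=x\prec y+x\succ y$: $(x\prec y)\prec z=x\prec(y\star z)$, $(x\succ y)\prec z=x\succ(y\prec z)$, $(x\star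 y)\succ z=x\succ(y\succ z)$. Free means isomorphic to the free NSh algebra on some vector space. *)

(* Defs.v *)
From HB Require Import structures.
From mathcomp Require Import all_boot all_order all_algebra.
From mathcomp Require Import finmap.
From mathcomp Require Export monalg.

Set Implicit Arguments.
Unset Strict Implicit.
Unset Printing Implicit Defensive.

Import GRing.Theory.
Local Open Scope ring_scope.

(* Noncommutative shuffle algebras, i.e. dendriform algebras.                 *)
Record is_NSh (k : fieldType) (A : lmodType k) (prec succ : A -> A -> A) :
    Prop := IsNSh {
  NSh_prec_bilinear : bilinear_for *:%R *:%R prec;
  NSh_succ_bilinear : bilinear_for *:%R *:%R succ;
  NSh_prec_star : forall x y z,
    prec (prec x y) z = prec x (prec y z + succ y z);
  NSh_succ_prec : forall x y z,
    prec (succ x y) z = succ x (prec y z);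
  NSh_star_succ : forall x y z,
    succ (prec x y + succ x y) z = succ x (succ y z)
}.

Definition NSh_morphism (k : fieldType) (A B : lmodType k)
    (precA succA : A -> A -> A) (precB succB : B -> B -> B) (f : A -> B) :
    Prop :=
  [/\ linear f,
      {morph f : x y / precA x y >-> precB x y} &
      {morph f : x y / succA x y >-> succB x y}].

(* (F, i) is the free NSh algebra on the vector space V: every linear map     *)
(* from V to an NSh algebra factors through i by a unique NSh morphism.       *)
Definition free_NSh_on (k : fieldType) (V F : lmodType k)
    (precF succF : F -> F -> F) (i : V -> F) : Prop :=
  [/\ is_NSh precF succF, linear i &
      forall (B : lmodType k) (precB succB : B -> B -> B) (f : V -> B),
        is_NSh precB succB -> linear f ->
        exists g : F -> B,
          [/\ NSh_morphism precF succF precB succB g,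
              g \o i =1 f &
              forall g' : F -> B, NSh_morphism precF succF precB succB g' ->
                g' \o i =1 f -> g' =1 g]].

Definition free_NSh (k : fieldType) (A : lmodType k)
    (prec succ : A -> A -> A) : Prop :=
  is_NSh prec succ /\
  exists (V F : lmodType k) (precF succF : F -> F -> F) (i : V -> F),
    free_NSh_on precF succF i /\
    exists2 phi : F -> A, NSh_morphism precF succF prec succ phi
                        & bijective phi.

Definition packed (u : seq nat) : bool :=
  perm_eq (undup u) (iota 1 (size (undup u))).

Lemma packedP (u : seq nat) :
  reflect (exists m, u =i iota 1 m) (packed u).
Proof.
apply: (iffP idP) => [/perm_mem eq_u | [m eq_u]].
  by exists (size (undup u)) => x; rewrite -mem_undup eq_u.
have eq_m : undup u =i iota 1 m by move=> x; rewrite mem_undup eq_u.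
have p_u := uniq_perm (undup_uniq u) (iota_uniq 1 m) eq_m.
by rewrite /packed (perm_size p_u) size_iota.
Qed.

(* Each letter is replaced by its rank among the distinct letters of u.       *)
Definition pack (u : seq nat) : seq nat :=
  [seq (index x (sort leq (undup u))).+1 | x <- u].

Definition same_order (u v : seq nat) : Prop :=
  size u = size v /\
  forall i j, (i < size u)%N -> (j < size u)%N ->
    (nth 0%N u i <= nth 0%N u j)%N = (nth 0%N v i <= nth 0%N v j)%N.

Lemma letters_sorted (u : seq nat) : sorted ltn (sort leq (undup u)).
Proof.
by rewrite ltn_sorted_uniq_leq sort_uniq undup_uniq sort_sorted //; apply: leq_total.
Qed.

Lemma mem_letters (u : seq nat) : sort leq (undup u) =i u.
Proof. by move=> x; rewrite mem_sort mem_undup. Qed.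

Lemma pack_packed (u : seq nat) : packed (pack u).
Proof.
apply/packedP; set s := sort leq (undup u); exists (size s) => x.
have us : uniq s by rewrite sort_uniq undup_uniq.
rewrite mem_iota add1n; apply/mapP/andP => [[y yu ->] | [x1 xs]].
  by rewrite !ltnS index_mem mem_letters yu.
have xs' : (x.-1 < size s)%N by case: x x1 xs.
exists (nth 0%N s x.-1); first by rewrite -mem_letters mem_nth.
by rewrite index_uniq // prednK.
Qed.

Lemma pack_same_order (u : seq nat) : same_order (pack u) u.
Proof.
split=> [|i j]; rewrite size_map // => iu ju.
rewrite !(nth_map 0%N) // ltnS.
set s := sort leq (undup u).
have ls : sorted ltn s by exact: letters_sorted.
have mi : nth 0%N u i \in s by rewrite mem_letters mem_nth.
have mj : nth 0%N u j \in s by rewrite mem_letters mem_nth.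
apply/idP/idP => [|le_ij]; last first.
  have [-> //|ne] := eqVneq (nth 0%N u i) (nth 0%N u j).
  rewrite leqNgt; apply/negP => lt_ji.
  have := (sorted_ltn_index ltn_trans ls _ _ mj mi lt_ji).
  by rewrite ltnNge le_ij.
rewrite leq_eqVlt => /orP[/eqP e|lt_ij].
  by rewrite (index_inj 0%N mi mj e).
exact: ltnW (sorted_ltn_index ltn_trans ls _ _ mi mj lt_ij).
Qed.

Lemma pack_unique (u v : seq nat) :
  packed v -> same_order v u -> v = pack u.
Proof.
move=> /packedP[m eq_v] [size_vu ord_vu].
pose f x := nth 0%N v (index x u).
have fE i : (i < size u)%N -> f (nth 0%N u i) = nth 0%N v i.
  move=> iu; have ku : (index (nth 0%N u i) u < size u)%N.
    by rewrite index_mem mem_nth.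
  have := nth_index 0%N (mem_nth 0%N iu); set j := index _ u => ej.
  rewrite /f -/j; apply/eqP.
  by rewrite eqn_leq !ord_vu ?size_vu // ej leqnn.
have f_le : {in u &, forall x y, (f x <= f y) = (x <= y)}%N.
  move=> x y xu yu.
  by rewrite /f ord_vu ?size_vu ?index_mem // !nth_index.
have v_map : v = map f u.
  apply: (@eq_from_nth _ 0%N) => [|i iv]; first by rewrite size_map.
  by rewrite size_vu in iv; rewrite (nth_map 0%N) // fE.
set s := sort leq (undup u).
have f_lt : {in s &, forall x y, (f x < f y) = (x < y)}%N.
  by move=> x y; rewrite !mem_letters => xu yu; rewrite !ltnNge f_le.
have fs_iota : map f s = iota 1 m.
  apply: (irr_sorted_eq ltn_trans ltnn).
  - rewrite sorted_map; apply: (@sub_in_sorted _ (mem s) ltn) (letters_sorted u).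
      by move=> x y xs ys /=; rewrite f_lt.
    exact/allP.
  - exact: iota_ltn_sorted.
  - move=> x; rewrite -eq_v v_map.
    by apply/mapP/mapP => -[y yu ->]; exists y; rewrite ?mem_letters // -mem_letters.
rewrite {1}v_map; apply/eq_in_map => x xu.
have xs : (index x s < size s)%N by rewrite index_mem mem_letters.
rewrite -[in f x](nth_index 0%N (_ : x \in s)) ?mem_letters //.
rewrite -(nth_map _ 0%N) // fs_iota nth_iota ?add1n //.
by rewrite -(size_iota 1 m) -fs_iota size_map.
Qed.

(* The default value head 0 u only matters for the empty word.               *)
Definition minl (u : seq nat) : nat := \big[minn/head 0%N u]_(x <- u) x.

Definition is_dpw (w : seq nat * seq nat) : bool :=
  [&& packed w.1, size w.2 == size w.1 & all (leq 1) w.2].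

(* Nonempty decorated packed words (sigma, d); d is the word d(1)...d(n).     *)
Record dpw : predArgType :=
  Dpw { dpw_val : seq nat * seq nat; _ : is_dpw dpw_val && (dpw_val.1 != [::]) }.

HB.instance Definition _ := [isSub for dpw_val].
HB.instance Definition _ := [Countable of dpw by <:].

Definition dword (x : dpw) : seq nat := (dpw_val x).1.
Definition ddeco (x : dpw) : seq nat := (dpw_val x).2.

(* The packed words of length n (their letters are at most n).                *)
Definition packed_words (n : nat) : seq (seq nat) :=
  [seq u <- [seq [seq i.+1 | i : 'I_n <- t] | t : n.-tuple 'I_n] | packed u].

(* The terms of the product of x and y, where c compares the two minima; see *)
(* mem_qshuffles and qshuffles_uniq.                                         *)
Definition qshuffles (c : rel nat) (x y : dpw) : seq dpw :=
  let p := size (dword x) in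
  let l := size (dword y) in
  pmap insub
    [seq (u, ddeco x ++ ddeco y) | u <- packed_words (p + l) &
       [&& pack (take p u) == dword x, pack (drop p u) == dword y &
           c (minl (take p u)) (minl (drop p u))]].

Lemma mem_packed_words n u :
  (u \in packed_words n) = packed u && (size u == n).
Proof.
rewrite mem_filter; case: (boolP (packed u)) => //= /packedP[m eq_u].
apply/mapP/eqP => [[t _ ->] | size_u].
  by rewrite size_map size_tuple.
have u_le x : x \in u -> (0 < x <= n)%N.
  move=> xu; move: (xu); rewrite eq_u mem_iota add1n ltnS => /andP[-> xm] /=.
  apply: leq_trans xm _; rewrite -size_u -(size_iota 1 m).
  by apply: uniq_leq_size (iota_uniq _ _) _ => y; rewrite -eq_u.
have [n0|n_gt0] := posnP n.
  move: size_u; rewrite n0 => /size0nil ->.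
  by exists [tuple]; rewrite ?mem_enum.
case: n n_gt0 size_u u_le => // n _ size_u u_le.
have size_t : size [seq inord x.-1 : 'I_n.+1 | x <- u] == n.+1.
  by rewrite size_map size_u.
exists (Tuple size_t); first by rewrite mem_enum.
rewrite /= -map_comp -[LHS]map_id; apply/eq_in_map => x /u_le /andP[x0 xn] /=.
by rewrite inordK prednK.
Qed.

Lemma packed_words_uniq n : uniq (packed_words n).
Proof.
apply: filter_uniq; rewrite map_inj_uniq ?enum_uniq // => t t' /inj_map eq_t.
by apply/val_inj/eq_t => i j [] /val_inj.
Qed.

Lemma qshuffles_uniq c x y : uniq (qshuffles c x y).
Proof.
apply: (pmap_uniq (insubK _)).
rewrite map_inj_in_uniq; first exact/filter_uniq/packed_words_uniq.
by move=> u u' _ _ [].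
Qed.

Lemma mem_qshuffles c x y w :
  let p := size (dword x) in
  (w \in qshuffles c x y) =
    [&& ddeco w == ddeco x ++ ddeco y,
        pack (take p (dword w)) == dword x,
        pack (drop p (dword w)) == dword y &
        c (minl (take p (dword w))) (minl (drop p (dword w)))].
Proof.
move=> p; rewrite mem_pmap_sub /=.
rewrite -[val w]/(dpw_val w) [dpw_val w]surjective_pairing.
rewrite -[_.1]/(dword w) -[_.2]/(ddeco w).
have size_d z : size (ddeco z) = size (dword z).
  by have /andP[/and3P[_ /eqP]] := valP z.
have packed_w : packed (dword w) by have /andP[/and3P[]] := valP w.
apply/mapP/and4P => [[u] | [/eqP eq_d px py cxy]].
  rewrite mem_filter => /andP[/and3P[px py cxy] _] [-> ->].
  by rewrite eqxx.
exists (dword w); last by rewrite eq_d.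
rewrite mem_filter px py cxy mem_packed_words packed_w /=.
by rewrite -size_d eq_d size_cat !size_d.
Qed.

(* The vector space with basis the nonempty decorated packed words.          *)
Definition QShd (k : fieldType) : lmodType k := {malg k[dpw]}.

(* Bilinear extension of the product given on the basis by qshuffles.        *)
Definition qsh_prod (k : fieldType) (c : rel nat) (x y : QShd k) : QShd k :=
  \sum_(a <- msupp x) \sum_(b <- msupp y)
    (x@_a * y@_b) *: \sum_(w <- qshuffles c a b) << w >>.

Lemma qsh_prod_basis (k : fieldType) (c : rel nat) (a b : dpw) :
  qsh_prod c (<< a >> : QShd k) << b >> = \sum_(w <- qshuffles c a b) << w >>.
Proof.
rewrite /qsh_prod !msuppU oner_eq0 !big_seq_fset1.
by rewrite !mcoeffU !eqxx mulr1 scale1r.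
Qed.

Definition qsh_prec (k : fieldType) : QShd k -> QShd k -> QShd k :=
  qsh_prod ltn.
Definition qsh_succ (k : fieldType) : QShd k -> QShd k -> QShd k :=
  qsh_prod gtn.
Definition qsh_bullet (k : fieldType) : QShd k -> QShd k -> QShd k :=
  qsh_prod eq_op.

Definition qsh_preceq (k : fieldType) (x y : QShd k) : QShd k :=
  qsh_prec x y + qsh_bullet x y.
Definition qsh_succeq (k : fieldType) (x y : QShd k) : QShd k :=
  qsh_succ x y + qsh_bullet x y.

(* Main.v *)
Require Import Defs.
From mathcomp Require Import all_boot all_order all_algebra.
From mathcomp Require Import finmap zify.

(* A NSh algebra filtered by a well-founded rank is free on V as soon as it   *)
(* is the direct sum of the l > v < r with v in V and l, r of lower rank or   *)
(* equal to the adjoined unit: a linear map out of V extends along this       *)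
(* decomposition by induction, and the NSh axioms make it a morphism.         *)
(* For (prec, succeq), split a packed word as u = l v r, where l is the       *)
(* longest prefix whose letters exceed all the others, and r is the longest   *)
(* suffix whose letters are not minimal in u but are smaller than all the     *)
(* non-minimal letters before it. Call v prime when its own l and r are       *)
(* empty. Then u is the unique term with the most inversions in               *)
(* l succeq v prec r, so these products, for v prime, form a triangular       *)
(* change of basis. Reversal of words exchanges (prec, succeq) with the       *)
(* opposite of (preceq, succ), which gives the other half.                    *)

Set Implicit Arguments.
Unset Strict Implicit.
Unset Printing Implicit Defensive.

Import GRing.Theory.
Local Open Scope ring_scope.

(** * A freeness criterion *)

(** The criterion is [graft_triangular_free]. A basis word [u] equals the graft [l succ (v prec r)]
    of its decomposition minus a tail of lower rank. The image of a graft under a morphism is forced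
    by the images of [l], [v] and [r], so the extension of a linear map is defined, and is unique,
    by induction on the rank ([lift_baseE], [lift_unique]). It is a morphism because multiplying a
    graft only enlarges one of its wings and leaves the generator in place ([prec_graft],
    [succ_graft]); the induction then applies to the wing.

    The products are dual to cutting words: [mcoeff_qsh_prod] writes a coefficient of a product as a
    sum over the cuts of a word. Each NSh axiom thereby becomes a propositional identity about the
    minima of three consecutive blocks ([qsh_prodA]).

    For triangularity, consider the terms of [l succeq (v prec r)]. The relative order inside each
    of the three zones is prescribed, and a minimal letter of [v] must lie below all of [r]. A word
    [u] cut at a high prefix and a low suffix inverts every other pair of positions in different
    zones, so its inversion set contains that of every other term, strictly ([inversions_grafted],
    [inversions_grafted_eq]). Every triple with [v] prime comes from such a word ([dec_graft_word]),
    and primeness of the core pins down the two cuts ([cut_unique]). *)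

Section LinearMaps.
Variables (k : fieldType) (U W : lmodType k) (f : U -> W).
Hypothesis f_lin : linear f.

Lemma linear_fun0 : f 0 = 0.
Proof. by have := f_lin (-1) 0 0; rewrite !scaleN1r oppr0 addr0 addNr. Qed.

Lemma linear_funD x y : f (x + y) = f x + f y.
Proof. by have := f_lin 1 x y; rewrite !scale1r. Qed.

Lemma linear_funZ a x : f (a *: x) = a *: f x.
Proof. by have := f_lin a x 0; rewrite linear_fun0 !addr0. Qed.

Lemma linear_funB x y : f (x - y) = f x - f y.
Proof. by rewrite -!scaleN1r linear_funD linear_funZ. Qed.

Lemma linear_fun_sum I (s : seq I) (P : pred I) (F : I -> U) :
  f (\sum_(i <- s | P i) F i) = \sum_(i <- s | P i) f (F i).
Proof. exact: (big_morph f linear_funD linear_fun0). Qed.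

End LinearMaps.

Section MalgLinear.
Variables (k : fieldType) (T : choiceType).
Implicit Types (x y : {malg k[T]}) (t : T).

Lemma malg_sumE x : x = \sum_(t <- msupp x) x@_t *: << t >>.
Proof.
rewrite {1}[x]monalgE; apply: eq_bigr => t _; apply/malgP => s.
by rewrite mcoeffZ !mcoeffU mulr_natr.
Qed.

Variable W : lmodType k.

Definition malg_ext (h : T -> W) x : W := \sum_(t <- msupp x) x@_t *: h t.

Lemma malg_extEw (h : T -> W) x (d : {fset T}) :
  (msupp x `<=` d)%fset -> malg_ext h x = \sum_(t <- d) x@_t *: h t.
Proof.
move=> sxd; apply: big_fset_incl => // t _ tx.
by rewrite mcoeff_outdom // scale0r.
Qed.

Lemma malg_ext_linear (h : T -> W) : linear (malg_ext h).
Proof.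
move=> a x y; set d := (msupp x `|` msupp y)%fset.
have xd : (msupp x `<=` d)%fset by exact: fsubsetUl.
have yd : (msupp y `<=` d)%fset by exact: fsubsetUr.
have sd : (msupp (a *: x + y) `<=` d)%fset.
  apply: fsubset_trans (msuppD_le _ _) _; rewrite fsubUset yd andbT.
  exact: fsubset_trans (msuppZ_le _ _) xd.
rewrite (malg_extEw h sd) (malg_extEw h xd) (malg_extEw h yd).
rewrite scaler_sumr -big_split; apply: eq_bigr => t _ /=.
by rewrite mcoeffD mcoeffZ scalerDl scalerA.
Qed.

Lemma malg_extU (h : T -> W) t : malg_ext h << t >> = h t.
Proof. by rewrite /malg_ext msuppU oner_eq0 big_seq_fset1 mcoeffUU scale1r. Qed.

Lemma eq_malg_ext (h1 h2 : T -> W) x :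
  {in msupp x, h1 =1 h2} -> malg_ext h1 x = malg_ext h2 x.
Proof. by move=> eq_h; apply: eq_big_seq => t /eq_h ->. Qed.

Lemma linear_malg_ext (f : {malg k[T]} -> W) :
  linear f -> f =1 malg_ext (fun t => f << t >>).
Proof.
move=> f_lin x; rewrite {1}[x]malg_sumE (linear_fun_sum f_lin).
by apply: eq_bigr => t _; rewrite (linear_funZ f_lin).
Qed.

Lemma eq_linear_malg (f1 f2 : {malg k[T]} -> W) (x : {malg k[T]}) :
    linear f1 -> linear f2 -> {in msupp x, forall t, f1 << t >> = f2 << t >>} ->
  f1 x = f2 x.
Proof.
move=> l1 l2 eqf; rewrite (linear_malg_ext l1) (linear_malg_ext l2).
exact: eq_malg_ext.
Qed.

End MalgLinear.

Section Graft.
Variables (k : fieldType) (A : lmodType k) (prec succ : A -> A -> A).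
Hypothesis A_NSh : is_NSh prec succ.

Let prec_linl z : linear (prec^~ z). Proof. by case: A_NSh => -[]. Qed.
Let prec_linr z : linear (prec z). Proof. by case: A_NSh => -[]. Qed.
Let succ_linl z : linear (succ^~ z). Proof. by case: A_NSh => _ []. Qed.
Let succ_linr z : linear (succ z). Proof. by case: A_NSh => _ []. Qed.

(* None plays the role of the unit adjoined to A. *)
Definition graft (l : option A) (v : A) (r : option A) : A :=
  let vr := if r is Some y then prec v y else v in
  if l is Some x then succ x vr else vr.

Definition star (x y : A) := prec x y + succ x y.

(** The two axioms for an outer [prec] let [z] pass to the right wing, where it is absorbed by the
    star product. The generator and the left wing do not move, which is what makes induction on the
    wings possible. *)
Lemma prec_graft l v r z :
  prec (graft l v r) z =
  graft l v (Some (if r is Some y then star y z else z)).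
Proof.
case: A_NSh => _ _ ps sp _.
by case: l r => [x|] [y|] //=; rewrite ?sp ?ps.
Qed.

Lemma succ_graft l v r z :
  succ z (graft l v r) =
  graft (Some (if l is Some x then star z x else z)) v r.
Proof.
case: A_NSh => _ _ _ _ ss.
by case: l r => [x|] [y|] //=; rewrite ?ss.
Qed.

Lemma graft_linl v r : linear (fun x => graft (Some x) v r).
Proof. by move=> a x y; apply: succ_linl. Qed.

Lemma graft_linr l v : linear (fun y => graft l v (Some y)).
Proof. by move=> a x y; case: l => [z|] /=; rewrite prec_linr ?succ_linr. Qed.

End Graft.

Lemma NSh_morphism_graft (k : fieldType) (A B : lmodType k)
    (pA sA : A -> A -> A) (pB sB : B -> B -> B) (g : A -> B) l v r :
    NSh_morphism pA sA pB sB g ->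
  g (graft pA sA l v r) = graft pB sB (omap g l) (g v) (omap g r).
Proof. by case=> _ gp gs; case: l r => [x|] [y|] /=; rewrite ?gs ?gp. Qed.

Section FreenessCriterion.
Variables (k : fieldType) (T : choiceType).
Notation A := {malg k[T]}.
Variables (prec succ : A -> A -> A).
Hypothesis A_NSh : is_NSh prec succ.

Let prec_linl z : linear (prec^~ z). Proof. by case: A_NSh => -[]. Qed.
Let prec_linr z : linear (prec z). Proof. by case: A_NSh => -[]. Qed.
Let succ_linl z : linear (succ^~ z). Proof. by case: A_NSh => _ []. Qed.
Let succ_linr z : linear (succ z). Proof. by case: A_NSh => _ []. Qed.

Variables (gen : pred T) (mu : T -> nat).
Variable dec : T -> option T * T * option T.

Definition ubase (o : option T) : option A := omap (fun t => << t >>) o.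

Definition graft_base (d : option T * T * option T) : A :=
  graft prec succ (ubase d.1.1) << d.1.2 >> (ubase d.2).

Definition graft_tail (u : T) : A := graft_base (dec u) - << u >>.

(** Grafts over generators are indexed by [T] through [dec], and [tail_mu] says that passing from
    words to grafts is unitriangular for the rank [mu]. *)
Hypothesis dec_gen : forall u, gen (dec u).1.2.
Hypothesis dec_onto : forall l v r, gen v -> exists u, dec u = (l, v, r).
Hypothesis dec_mul : forall u l, (dec u).1.1 = Some l -> (mu l < mu u)%N.
Hypothesis dec_mur : forall u r, (dec u).2 = Some r -> (mu r < mu u)%N.
Hypothesis tail_mu : forall u w, w \in msupp (graft_tail u) -> (mu w < mu u)%N.

Let gens := {v : T | gen v}.
Let V : lmodType k := {malg k[gens]}.
Let iota : V -> A := malg_ext (fun v : gens => << val v >>).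

Section UniversalProperty.
Variables (B : lmodType k) (precB succB : B -> B -> B) (f : V -> B).
Hypotheses (B_NSh : is_NSh precB succB) (f_lin : linear f).

Let precB_linl z : linear (precB^~ z). Proof. by case: B_NSh => -[]. Qed.
Let precB_linr z : linear (precB z). Proof. by case: B_NSh => -[]. Qed.
Let succB_linl z : linear (succB^~ z). Proof. by case: B_NSh => _ []. Qed.
Let succB_linr z : linear (succB z). Proof. by case: B_NSh => _ []. Qed.

Let fgen (v : T) : B := oapp (fun s : gens => f << s >>) 0 (insub v).

(** The recursion descends along [mu], into both wings and into the support of the tail. The fuel
    makes it structural, and [lift_fuel_stable] shows that any fuel above [mu u] gives the same
    value. *)
Fixpoint lift_fuel (n : nat) (u : T) : B :=
  if n is m.+1 then
    let h := lift_fuel m in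
    graft precB succB (omap h (dec u).1.1) (fgen (dec u).1.2) (omap h (dec u).2)
      - malg_ext h (graft_tail u)
  else 0.

Definition lift_base (u : T) : B := lift_fuel (mu u).+1 u.

Lemma lift_fuel_stable n m u :
  (mu u < n)%N -> (mu u < m)%N -> lift_fuel n u = lift_fuel m u.
Proof.
elim: n m u => [//|n IHn] [//|m] u; rewrite !ltnS => un um /=.
have IH t : (mu t < mu u)%N -> lift_fuel n t = lift_fuel m t.
  by move=> tu; apply: IHn; apply: leq_trans tu _.
congr (graft _ _ _ _ _ - _).
- by case E: (dec u).1.1 => [l|] //=; rewrite IH // (dec_mul E).
- by case E: (dec u).2 => [l|] //=; rewrite IH // (dec_mur E).
- by apply: eq_malg_ext => w /tail_mu; apply: IH.
Qed.

Let g := malg_ext lift_base.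
Let g_lin : linear g. Proof. exact: malg_ext_linear. Qed.
Let gU t : g << t >> = lift_base t. Proof. exact: malg_extU. Qed.

Lemma lift_baseE u :
  lift_base u = graft precB succB (omap lift_base (dec u).1.1)
    (fgen (dec u).1.2) (omap lift_base (dec u).2) - g (graft_tail u).
Proof.
have stable t : (mu t < mu u)%N -> lift_fuel (mu u) t = lift_base t.
  by move=> tu; apply: lift_fuel_stable.
rewrite {1}/lift_base /=; congr (graft _ _ _ _ _ - _).
- by case E: (dec u).1.1 => [l|] //=; rewrite stable // (dec_mul E).
- by case E: (dec u).2 => [l|] //=; rewrite stable // (dec_mur E).
- by apply: eq_malg_ext => w /tail_mu; apply: stable.
Qed.

(** By [dec_onto] the graft is that of some word [u], and there the identity is the defining
    recursion of [lift_base]. *)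
Lemma lift_graft_base l v r : gen v ->
  g (graft_base (l, v, r)) =
  graft precB succB (omap lift_base l) (fgen v) (omap lift_base r).
Proof.
move=> gv; have [u Eu] := dec_onto l r gv.
have -> : graft_base (l, v, r) = << u >> + graft_tail u.
  by rewrite /graft_tail Eu addrCA addrN addr0.
by rewrite (linear_funD g_lin) gU lift_baseE Eu /= subrK.
Qed.

(** Absorbing a factor turns a basis wing into a linear combination, so the previous identity is
    extended linearly in the wing. *)
Lemma lift_graft_r l v y : gen v ->
  g (graft prec succ (ubase l) << v >> (Some y)) =
  graft precB succB (omap lift_base l) (fgen v) (Some (g y)).
Proof.
move=> gv.
apply: (@eq_linear_malg _ _ _
  (fun y => g (graft prec succ (ubase l) << v >> (Some y)))
  (fun y => graft precB succB (omap lift_base l) (fgen v) (Some (g y)))).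
- by move=> a x z; rewrite (graft_linr A_NSh) g_lin.
- by move=> a x z; rewrite g_lin (graft_linr B_NSh).
- by move=> t _; have := lift_graft_base l (Some t) gv; rewrite gU.
Qed.

Lemma lift_graft_l x v r : gen v ->
  g (graft prec succ (Some x) << v >> (ubase r)) =
  graft precB succB (Some (g x)) (fgen v) (omap lift_base r).
Proof.
move=> gv.
apply: (@eq_linear_malg _ _ _
  (fun x => g (graft prec succ (Some x) << v >> (ubase r)))
  (fun x => graft precB succB (Some (g x)) (fgen v) (omap lift_base r))).
- by move=> a y z; rewrite (graft_linl A_NSh) g_lin.
- by move=> a y z; rewrite g_lin (graft_linl B_NSh).
- by move=> t _; have := lift_graft_base (Some t) r gv; rewrite gU.
Qed.

(** Induction on the sum of the ranks, for both products together because the wings are multiplied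
    by the star product. For [prec] the left factor is expanded as graft minus tail, for [succ] the
    right one. *)
Lemma lift_base_morph a b :
  g (prec << a >> << b >>) = precB (lift_base a) (lift_base b) /\
  g (succ << a >> << b >>) = succB (lift_base a) (lift_base b).
Proof.
have [n] := ubnP (mu a + mu b)%N; elim: n a b => // n IHn a b; rewrite ltnS => ab_n.
have IHl t : (mu t < mu a)%N -> 
    g (prec << t >> << b >>) = precB (lift_base t) (lift_base b) /\
    g (succ << t >> << b >>) = succB (lift_base t) (lift_base b).
  by move=> ta; apply: IHn; apply: leq_trans ab_n; rewrite ltn_add2r.
have IHr t : (mu t < mu b)%N ->
    g (prec << a >> << t >>) = precB (lift_base a) (lift_base t) /\
    g (succ << a >> << t >>) = succB (lift_base a) (lift_base t).
  by move=> ta; apply: IHn; apply: leq_trans ab_n; rewrite ltn_add2l.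
have headE u : << u >> = graft_base (dec u) - graft_tail u.
  by rewrite /graft_tail opprB addrCA addrN addr0.
split.
  rewrite {1}[<< a >>]headE (linear_funB (prec_linl _)) (linear_funB g_lin).
  have -> : g (prec (graft_tail a) << b >>) =
            precB (g (graft_tail a)) (lift_base b).
    apply: (@eq_linear_malg _ _ _ (fun x => g (prec x << b >>))
                                  (fun x => precB (g x) (lift_base b))).
    - by move=> c x y; rewrite prec_linl g_lin.
    - by move=> c x y; rewrite g_lin precB_linl.
    - by move=> t /tail_mu /IHl[-> _]; rewrite gU.
  rewrite [lift_base a]lift_baseE (linear_funB (precB_linl _)); congr (_ - _).
  (* The tail is settled by induction; in the graft, the new right wing is the star of [r] and [b],
     and [r] has lower rank than [a]. *)
  rewrite (prec_graft A_NSh) (prec_graft B_NSh) lift_graft_r //.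
  case E: (dec a).2 => [r|] /=; last by rewrite gU.
  have [rp rs] := IHl _ (dec_mur E).
  by rewrite /star (linear_funD g_lin) rp rs.
rewrite {1}[<< b >>]headE (linear_funB (succ_linr _)) (linear_funB g_lin).
have -> : g (succ << a >> (graft_tail b)) =
          succB (lift_base a) (g (graft_tail b)).
  apply: (@eq_linear_malg _ _ _ (fun x => g (succ << a >> x))
                                (fun x => succB (lift_base a) (g x))).
  - by move=> c x y; rewrite succ_linr g_lin.
  - by move=> c x y; rewrite g_lin succB_linr.
  - by move=> t /tail_mu /IHr[_ ->]; rewrite gU.
rewrite [lift_base b]lift_baseE (linear_funB (succB_linr _)); congr (_ - _).
rewrite (succ_graft A_NSh) (succ_graft B_NSh) lift_graft_l //.
case E: (dec b).1.1 => [r|] /=; last by rewrite gU.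
have [rp rs] := IHr _ (dec_mul E).
by rewrite /star (linear_funD g_lin) rp rs.
Qed.

Lemma bilinear_malg_morph (m : A -> A -> A) (mB : B -> B -> B) :
    (forall z, linear (m^~ z)) -> (forall z, linear (m z)) ->
    (forall z, linear (mB^~ z)) -> (forall z, linear (mB z)) ->
    (forall a b, g (m << a >> << b >>) = mB (g << a >>) (g << b >>)) ->
  {morph g : x y / m x y >-> mB x y}.
Proof.
move=> ml mr mBl mBr mU x y.
apply: (@eq_linear_malg _ _ _ (fun x => g (m x y)) (fun x => mB (g x) (g y))).
- by move=> c z t; rewrite ml g_lin.
- by move=> c z t; rewrite g_lin mBl.
move=> a _.
apply: (@eq_linear_malg _ _ _ (fun y => g (m << a >> y))
                              (fun y => mB (g << a >>) (g y))) => [c z t|c z t|b _].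
- by rewrite mr g_lin.
- by rewrite g_lin mBr.
- exact: mU.
Qed.

Lemma lift_morphism : NSh_morphism prec succ precB succB g.
Proof.
split=> //; apply: bilinear_malg_morph => // a b.
- by rewrite !gU; case: (lift_base_morph a b).
- by rewrite !gU; case: (lift_base_morph a b).
Qed.

Lemma lift_iota : g \o iota =1 f.
Proof.
move=> x; apply: (@eq_linear_malg _ _ _ (g \o iota) f) => //.
  by move=> a y z /=; rewrite /iota malg_ext_linear g_lin.
move=> v _ /=; rewrite /iota malg_extU.
have := lift_graft_base None None (valP v).
by rewrite /graft_base /= => ->; rewrite /fgen valK.
Qed.

Lemma lift_unique (g' : A -> B) :
  NSh_morphism prec succ precB succB g' -> g' \o iota =1 f -> g' =1 g.
Proof.
move=> g'_mor g'_iota x; have [g'_lin _ _] := g'_mor.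
apply: eq_linear_malg => // u _; rewrite gU.
have [n] := ubnP (mu u); elim: n u => // n IHn u; rewrite ltnS => un.
have IH t : (mu t < mu u)%N -> g' << t >> = lift_base t.
  by move=> tu; apply: IHn; apply: leq_trans tu un.
have -> : << u >> = graft_base (dec u) - graft_tail u.
  by rewrite /graft_tail opprB addrCA addrN addr0.
rewrite (linear_funB g'_lin) lift_baseE; congr (_ - _); last first.
  by apply: eq_linear_malg => // t /tail_mu /IH ->; rewrite gU.
rewrite (NSh_morphism_graft _ _ _ g'_mor); congr graft.
- by case E: (dec u).1.1 => [l|] //=; rewrite IH // (dec_mul E).
- have gv := dec_gen u; have := g'_iota << (exist (fun t => gen t) _ gv : gens) >>.
  by rewrite /= /iota malg_extU /= => ->; rewrite /fgen insubT.
- by case E: (dec u).2 => [l|] //=; rewrite IH // (dec_mur E).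
Qed.

End UniversalProperty.

Theorem graft_triangular_free : free_NSh prec succ.
Proof.
(* The algebra itself is the free model, with the identity as isomorphism. *)
split=> //; exists V, A, prec, succ, iota; split; last first.
  by exists id => //; exists id.
split=> //; first exact: malg_ext_linear.
move=> B pB sB f hB f_lin; exists (malg_ext (lift_base pB sB f)); split.
- exact: lift_morphism.
- exact: lift_iota.
- exact: lift_unique.
Qed.

End FreenessCriterion.

(** * Factors of packed words and the products *)

Definition len (w : dpw) : nat := size (dword w).
Definition letter (w : dpw) (i : nat) : nat := nth 0%N (dword w) i.

Lemma packed_dword w : packed (dword w).
Proof. by have /andP[/and3P[]] := valP w. Qed.

Lemma size_ddeco w : size (ddeco w) = len w.
Proof. by have /andP[/and3P[_ /eqP]] := valP w. Qed.

Lemma ddeco_gt0 w : all (leq 1) (ddeco w).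
Proof. by have /andP[/and3P[]] := valP w. Qed.

Lemma len_gt0 w : (0 < len w)%N.
Proof. by have /andP[_] := valP w; rewrite -size_eq0 lt0n. Qed.

Lemma pack_same_orderE u v : same_order u v -> pack u = pack v.
Proof.
move=> [suv uv]; apply: pack_unique (pack_packed u) _.
have [spu pu] := pack_same_order u.
by split=> [|i j iu ju]; rewrite ?spu // pu // uv // -spu.
Qed.

Lemma pack_id u : packed u -> pack u = u.
Proof. by move=> pu; symmetry; apply: pack_unique. Qed.

(** Packing is canonical, so the comparisons between letters determine a packed word. Later
    equalities of words are reduced to comparisons of positions, without computing packed
    letters. *)
Lemma dpw_inj x y :
    len x = len y ->
    (forall i j, (i < len x)%N -> (j < len x)%N ->
       (letter x i <= letter x j)%N = (letter y i <= letter y j)%N) ->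
  ddeco x = ddeco y -> x = y.
Proof.
move=> lxy oxy dxy; apply/val_inj.
rewrite [LHS](surjective_pairing (dpw_val x)).
rewrite [RHS](surjective_pairing (dpw_val y)); congr (_, _) => //.
rewrite -[LHS]pack_id ?packed_dword // -[RHS]pack_id ?packed_dword //.
exact: pack_same_orderE.
Qed.

(* The default x0 is irrelevant when u is nonempty and d decorates it. *)
Definition mkdpw (x0 : dpw) (u d : seq nat) : dpw := insubd x0 (pack u, d).

Section MkDpw.
Variables (x0 : dpw) (u d : seq nat).
Hypotheses (u_gt0 : (0 < size u)%N) (size_d : size d = size u).
Hypothesis d_gt0 : all (leq 1) d.

Lemma val_mkdpw : dpw_val (mkdpw x0 u d) = (pack u, d).
Proof.
have [spu _] := pack_same_order u.
apply: (insubdK x0); rewrite unfold_in /is_dpw /= pack_packed size_d spu eqxx.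
by rewrite d_gt0 -size_eq0 spu -lt0n.
Qed.

Lemma dword_mkdpw : dword (mkdpw x0 u d) = pack u.
Proof. by rewrite /dword val_mkdpw. Qed.

Lemma ddeco_mkdpw : ddeco (mkdpw x0 u d) = d.
Proof. by rewrite /ddeco val_mkdpw. Qed.

Lemma len_mkdpw : len (mkdpw x0 u d) = size u.
Proof. by rewrite /len dword_mkdpw size_map. Qed.

Lemma letter_mkdpw i j : (i < size u)%N -> (j < size u)%N ->
  (letter (mkdpw x0 u d) i <= letter (mkdpw x0 u d) j)%N =
  (nth 0%N u i <= nth 0%N u j)%N.
Proof.
move=> iu ju; rewrite /letter dword_mkdpw.
by have [spu ->] := pack_same_order u; rewrite ?spu.
Qed.

End MkDpw.

Definition slice (i j : nat) (s : seq nat) := drop i (take j s).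

Lemma size_slice i j s : (j <= size s)%N -> size (slice i j s) = (j - i)%N.
Proof. by move=> js; rewrite size_drop size_takel. Qed.

Lemma nth_slice i j s x : (x < j - i)%N ->
  nth 0%N (slice i j s) x = nth 0%N s (i + x).
Proof. by move=> xij; rewrite nth_drop nth_take //; lia. Qed.

Lemma slice_slice a b i j s : (a <= b)%N -> (j <= b - a)%N ->
  slice i j (slice a b s) = slice (a + i) (a + j) s.
Proof.
move=> ab jba; rewrite /slice take_drop drop_drop take_takel; last by lia.
by rewrite addnC [(j + a)%N]addnC.
Qed.

Definition dsub (i j : nat) (w : dpw) : dpw :=
  mkdpw w (slice i j (dword w)) (slice i j (ddeco w)).

Section DSub.
Variables (i j : nat) (w : dpw).
Hypotheses (ij : (i < j)%N) (jw : (j <= len w)%N).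

Let sz : size (slice i j (dword w)) = (j - i)%N.
Proof. exact: size_slice. Qed.
Let sz_gt0 : (0 < size (slice i j (dword w)))%N.
Proof. by rewrite sz subn_gt0. Qed.
Let szd : size (slice i j (ddeco w)) = size (slice i j (dword w)).
Proof. by rewrite sz size_slice // size_ddeco. Qed.
Let d_gt0 : all (leq 1) (slice i j (ddeco w)).
Proof. by apply/allP => x /mem_drop /mem_take /(allP (ddeco_gt0 w)). Qed.

Lemma dword_dsub : dword (dsub i j w) = pack (slice i j (dword w)).
Proof. exact: dword_mkdpw. Qed.

Lemma ddeco_dsub : ddeco (dsub i j w) = slice i j (ddeco w).
Proof. exact: ddeco_mkdpw. Qed.

Lemma len_dsub : len (dsub i j w) = (j - i)%N.
Proof. by rewrite len_mkdpw. Qed.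

Lemma letter_dsub x y : (x < j - i)%N -> (y < j - i)%N ->
  (letter (dsub i j w) x <= letter (dsub i j w) y)%N =
  (letter w (i + x) <= letter w (i + y))%N.
Proof.
move=> xij yij; rewrite letter_mkdpw ?nth_slice //; by rewrite sz.
Qed.

End DSub.

Lemma dsub_full w : dsub 0 (len w) w = w.
Proof.
have wl := leqnn (len w); have w0 := len_gt0 w.
apply: dpw_inj; rewrite ?len_dsub ?subn0 //.
  by move=> i j iw jw; rewrite letter_dsub ?subn0.
by rewrite ddeco_dsub // /slice drop0 -size_ddeco take_size.
Qed.

Lemma dsub_dsub a b i j w :
    (i < j)%N -> (j <= b - a)%N -> (b <= len w)%N ->
  dsub i j (dsub a b w) = dsub (a + i) (a + j) w.
Proof.
move=> ij jba bw; have ab : (a < b)%N by lia.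
have aij : (a + i < a + j)%N by lia.
have ajw : (a + j <= len w)%N by lia.
have js : (j <= len (dsub a b w))%N by rewrite len_dsub.
apply: dpw_inj; rewrite ?len_dsub //; first by lia.
  move=> x y xij yij; rewrite !letter_dsub //; try by lia.
  by rewrite !addnA.
by rewrite !ddeco_dsub // slice_slice // ltnW.
Qed.

Lemma minl_le (s : seq nat) x : x \in s -> (minl s <= x)%N.
Proof.
rewrite /minl; move: (head _ _) => h; elim: s => // y s IHs.
rewrite big_cons inE geq_min => /predU1P[->|/IHs ->]; first by rewrite leqnn.
by rewrite orbT.
Qed.

Lemma minl_mem (s : seq nat) : (0 < size s)%N -> minl s \in s.
Proof.
case: s => // x s _.
suff: forall h t, \big[minn/h]_(y <- t) y \in h :: t.
  by move=> /(_ x (x :: s)); rewrite !inE orbA orbb.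
move=> h; elim=> [|y t IHt]; first by rewrite big_nil mem_head.
rewrite big_cons; have [_|_] := leqP y; first by rewrite !inE eqxx orbT.
by move: IHt; rewrite !inE => /orP[]->; rewrite ?orbT.
Qed.

Definition smin (w : dpw) (i j : nat) : nat := minl (slice i j (dword w)).

Lemma smin_le w i j x : (i <= x < j)%N -> (j <= len w)%N ->
  (smin w i j <= letter w x)%N.
Proof.
move=> /andP[ix xj] jw; apply: minl_le.
rewrite /letter -(subnKC ix) -(@nth_slice _ j); last by lia.
by rewrite mem_nth // size_slice //; lia.
Qed.

Lemma smin_ex w i j : (i < j)%N -> (j <= len w)%N ->
  exists2 x, (i <= x < j)%N & smin w i j = letter w x.
Proof.
move=> ij jw; have sz := size_slice i jw.
have /(nthP 0%N)[x] : smin w i j \in slice i j (dword w).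
  by apply: minl_mem; rewrite sz subn_gt0.
rewrite sz => xij <-; exists (i + x)%N; first by lia.
exact: nth_slice.
Qed.

Lemma smin_cat w i j l : (i < j)%N -> (j < l)%N -> (l <= len w)%N ->
  smin w i l = minn (smin w i j) (smin w j l).
Proof.
move=> ij jl lw; have il := ltn_trans ij jl; have jw := leq_trans (ltnW jl) lw.
have [y yij Ey] := smin_ex ij jw; have [z zjl Ez] := smin_ex jl lw.
have [x xil Ex] := smin_ex il lw.
apply/eqP; rewrite eqn_leq leq_min Ey Ez !smin_le //; try by lia.
rewrite geq_min -Ey -Ez Ex; have [xj|jx] := ltnP x j.
  by rewrite smin_le //; lia.
by rewrite [X in _ || X]smin_le ?orbT //; lia.
Qed.

(** Packing changes the values of the minima but not their comparison: a factor attains its minimum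
    at a common position before and after packing. *)
Lemma smin_dsub_le a b i j i' j' w :
    (b <= len w)%N -> (i < j <= b - a)%N -> (i' < j' <= b - a)%N ->
  (smin (dsub a b w) i j <= smin (dsub a b w) i' j')%N =
  (smin w (a + i) (a + j) <= smin w (a + i') (a + j'))%N.
Proof.
have smin_dsub s t : (b <= len w)%N -> (s < t <= b - a)%N ->
  exists2 x, (s <= x < t)%N & smin (dsub a b w) s t = letter (dsub a b w) x /\
     smin w (a + s) (a + t) = letter w (a + x).
  move=> bw /andP[st tba]; have ab : (a < b)%N by lia.
  have tl : (t <= len (dsub a b w))%N by rewrite len_dsub.
  have [x xst Ex] := smin_ex st tl; exists x => //; split=> //.
  have ast : (a + s < a + t)%N by lia.
  have atw : (a + t <= len w)%N by lia.
  have [y yst Ey] := smin_ex ast atw.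
  apply/eqP; rewrite eqn_leq smin_le //=; last by lia.
  have ya : (a + (y - a) = y)%N by lia.
  rewrite Ey -ya -(@letter_dsub a b) //; try by lia.
  by rewrite -Ex smin_le //; lia.
move=> bw ij ij'; have [x xij [-> ->]] := smin_dsub _ _ bw ij.
have [y yij [-> ->]] := smin_dsub _ _ bw ij'.
by rewrite letter_dsub //; lia.
Qed.

Definition order_invariant (c : rel nat) : Prop :=
  forall a b a' b', (a <= b)%N = (a' <= b')%N -> (b <= a)%N = (b' <= a')%N ->
    c a b = c a' b'.

(** * Coefficients of the products and associativity *)

Section Product.
Variable k : fieldType.
Implicit Types (x y z : QShd k) (a b w : dpw) (c d : rel nat).

Lemma mem_qshufflesE c a b w :
  (w \in qshuffles c a b) =
  [&& len w == (len a + len b)%N, c (smin w 0 (len a)) (smin w (len a) (len w)),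
      dsub 0 (len a) w == a & dsub (len a) (len w) w == b].
Proof.
rewrite mem_qshuffles -/(len a).
have -> : smin w 0 (len a) = minl (take (len a) (dword w)).
  by rewrite /smin /slice drop0.
have -> : smin w (len a) (len w) = minl (drop (len a) (dword w)).
  by rewrite /smin /slice take_size.
have a0 := len_gt0 a; have b0 := len_gt0 b.
have [lw|lw] /= := eqVneq (len w) (len a + len b)%N; last first.
  apply/negP => /andP[/eqP dw _]; case/eqP: lw.
  by rewrite -!size_ddeco dw size_cat.
have aw : (len a <= len w)%N by lia.
have law : (len a < len w)%N by lia.
have Ea : (dsub 0 (len a) w == a) =
    (take (len a) (ddeco w) == ddeco a) &&
    (pack (take (len a) (dword w)) == dword a).
  apply/eqP/andP => [{2 4}<-|[/eqP da /eqP wa]].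
    by rewrite dword_dsub // ddeco_dsub // /slice !drop0.
  apply/val_inj; rewrite [RHS](surjective_pairing (dpw_val a)).
  rewrite [LHS](surjective_pairing (dpw_val _)); congr (_, _).
    by rewrite -/(dword _) dword_dsub // /slice drop0.
  by rewrite -/(ddeco _) ddeco_dsub // /slice drop0.
have Eb : (dsub (len a) (len w) w == b) =
    (drop (len a) (ddeco w) == ddeco b) &&
    (pack (drop (len a) (dword w)) == dword b).
  have dE : slice (len a) (len w) (ddeco w) = drop (len a) (ddeco w).
    by rewrite /slice -(size_ddeco w) take_size.
  have wE : slice (len a) (len w) (dword w) = drop (len a) (dword w).
    by rewrite /slice take_size.
  apply/eqP/andP => [<-|[/eqP da /eqP wa]].
    by rewrite dword_dsub // ddeco_dsub // dE wE.
  apply/val_inj; rewrite [RHS](surjective_pairing (dpw_val b)).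
  rewrite [LHS](surjective_pairing (dpw_val _)); congr (_, _).
    by rewrite -/(dword _) dword_dsub // wE.
  by rewrite -/(ddeco _) ddeco_dsub // dE.
rewrite Ea Eb -{1}(cat_take_drop (len a) (ddeco w)) eqseq_cat; last first.
  by rewrite size_takel ?size_ddeco.
by do ![case: eqP => _ //=]; rewrite ?andbF ?andbT.
Qed.

Lemma mcoeff_base a b : (<< a >> : QShd k)@_b = (a == b)%:R.
Proof. exact: mcoeffU. Qed.

Lemma sum_mcoeff_eq x a : \sum_(b <- msupp x) x@_b * (b == a)%:R = x@_a.
Proof.
rewrite [in RHS](malg_sumE x) raddf_sum; apply: eq_bigr => b _.
by rewrite /= mcoeffZ mcoeff_base.
Qed.

Lemma mcoeff_qsh_base c a b w :
  (qsh_prod c (<< a >> : QShd k) << b >>)@_w = (w \in qshuffles c a b)%:R.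
Proof.
rewrite qsh_prod_basis raddf_sum.
under eq_bigr => v _ do rewrite /= mcoeff_base.
have [wq|wq] := boolP (w \in _).
  rewrite (bigD1_seq w) ?qshuffles_uniq //= eqxx big1 ?addr0 // => v.
  by move=> /negPf ->.
by rewrite big_seq big1 // => v vq; case: eqP vq wq => // -> ->.
Qed.

(** Dual description by deconcatenation: [w] can only arise from [a] and [b] at the cut [len a], and
    [a], [b] are then its packed factors. *)
Lemma mcoeff_qsh_prod c x y w :
  (qsh_prod c x y)@_w =
  \sum_(1 <= p < len w) (c (smin w 0 p) (smin w p (len w)))%:R *
     (x@_(dsub 0 p w) * y@_(dsub p (len w) w)).
Proof.
pose cp p := (c (smin w 0 p) (smin w p (len w)))%:R : k.
have memE a b : (w \in qshuffles c a b)%:R =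
    \sum_(1 <= p < len w) cp p * ((a == dsub 0 p w)%:R * (b == dsub p (len w) w)%:R).
  have [law|law] := ltnP (len a) (len w); last first.
    rewrite mem_qshufflesE; have b0 := len_gt0 b.
    case: eqP => [|_] /=; first by lia.
    rewrite big_nat big1 // => p pw; case: eqP => [ap|]; last by rewrite mul0r mulr0.
    by move: law; rewrite ap len_dsub //; lia.
  rewrite (bigD1_seq (len a)) ?iota_uniq ?mem_index_iota ?len_gt0 //=.
  rewrite big_nat_cond big1 ?addr0; last first.
    move=> p /andP[/andP[p0 pw] pa]; case: eqP => [ap|]; last by rewrite mul0r mulr0.
    by case/eqP: pa; rewrite ap len_dsub // ?subn0 // ltnW.
  rewrite mem_qshufflesE ![_ == dsub _ _ _]eq_sym /cp -!natrM !mulnb.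
  case: eqP => //= lw.
  case: (dsub (len a) _ _ =P b) => [Eb|]; last by rewrite !andbF.
  by move: lw; rewrite -Eb len_dsub // subnKC // ltnW.
rewrite /qsh_prod raddf_sum.
under eq_bigr => a _.
  rewrite raddf_sum; under eq_bigr => b _.
    rewrite /= mcoeffZ -qsh_prod_basis mcoeff_qsh_base.
    rewrite memE mulr_sumr; over.
  rewrite exchange_big; over.
rewrite exchange_big /=; apply: eq_bigr => p _.
rewrite -/(cp p) -(sum_mcoeff_eq x) -(sum_mcoeff_eq y) mulr_suml mulr_sumr.
apply: eq_bigr => a _; rewrite !mulr_sumr; apply: eq_bigr => b _.
by rewrite mulrCA [in RHS]mulrACA.
Qed.

Lemma qsh_prod_linl c z : linear (fun x : QShd k => qsh_prod c x z).
Proof.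
move=> a x y; apply/malgP => w; rewrite mcoeffD mcoeffZ !mcoeff_qsh_prod.
rewrite mulr_sumr -big_split; apply: eq_bigr => p _ /=.
by rewrite mcoeffD mcoeffZ mulrDl mulrDr -mulrA [X in X + _]mulrCA.
Qed.

Lemma qsh_prod_linr c z : linear (fun x : QShd k => qsh_prod c z x).
Proof.
move=> a x y; apply/malgP => w; rewrite mcoeffD mcoeffZ !mcoeff_qsh_prod.
rewrite mulr_sumr -big_split; apply: eq_bigr => p _ /=.
by rewrite mcoeffD mcoeffZ !mulrDr [_ * (a * _)]mulrCA [X in X + _]mulrCA.
Qed.

(** Both sides sum over two cuts of [w], and the hypothesis on [i j l] matches the conditions on the
    three block minima, [minn] being the minimum of two joined blocks. Order invariance lets the
    relation of the inner product, evaluated on a packed factor, be read in [w]. *)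
Lemma qsh_prodA c1 c2 d1 d2 x y z :
    order_invariant c1 -> order_invariant d2 ->
    (forall i j l, c1 i j && c2 (minn i j) l = d2 j l && d1 i (minn j l)) ->
  qsh_prod c2 (qsh_prod c1 x y) z = qsh_prod d1 x (qsh_prod d2 y z).
Proof.
move=> inv_c1 inv_d2 c12d12; apply/malgP => w.
(* The contribution of the pair of cuts [q < p], to which both sides are reduced. *)
pose G q p : k := (c1 (smin w 0 q) (smin w q p) && c2 (smin w 0 p) (smin w p (len w)))%:R *
   (x@_(dsub 0 q w) * (y@_(dsub q p w) * z@_(dsub p (len w) w))).
transitivity (\sum_(1 <= p < len w) \sum_(1 <= q < len w | (q < p)%N) G q p).
  rewrite mcoeff_qsh_prod; apply: eq_big_nat => p /andP[p0 pw].
  have pw' := ltnW pw.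
  rewrite mcoeff_qsh_prod mulr_suml mulr_sumr len_dsub // subn0.
  rewrite (big_nat_widen 1 p (len w)) //; apply: congr_big_nat => // q /andP[q0 qp].
  rewrite !dsub_dsub //; try by lia.
  rewrite /G !add0n (inv_c1 _ _ (smin w 0 q) (smin w q p)); last 2 first.
  - by rewrite smin_dsub_le //; lia.
  - by rewrite smin_dsub_le //; lia.
  by rewrite -mulnb natrM -!mulrA mulrCA.
rewrite (exchange_big_dep xpredT) //= mcoeff_qsh_prod.
apply: eq_big_nat => q /andP[q0 qw].
rewrite mcoeff_qsh_prod len_dsub // !mulr_sumr.
transitivity (\sum_(1 + q <= p < len w) G q p).
  by rewrite [RHS](big_nat_widenl _ 1) ?leq_addr //.
rewrite big_addn; apply: eq_big_nat => r /andP[r0 rw].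
rewrite /G addnC !dsub_dsub //; try by lia.
rewrite subnKC ?(ltnW qw) //.
rewrite (inv_d2 _ _ (smin w q (q + r)) (smin w (q + r) (len w))); last 2 first.
- by rewrite smin_dsub_le //; rewrite ?addn0 ?subnKC //; lia.
- by rewrite smin_dsub_le //; rewrite ?addn0 ?subnKC //; lia.
rewrite addn0 (@smin_cat w 0 q (q + r)) //; try by lia.
rewrite (@smin_cat w q (q + r) (len w)) //; try by lia.
by rewrite c12d12 -mulnb natrM -mulrA mulrCA; congr (_ * _); rewrite mulrCA.
Qed.

End Product.

(** * Decomposition of packed words *)

Section Decomposition.
Implicit Types (u v w : dpw) (p q a b : nat).
Local Open Scope nat_scope.

Definition ismin u i := [forall j : 'I_(len u), letter u i <= letter u j].

(** The comparison would hold vacuously at [p = len u]; the strict bound leaves letters for the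
    core. *)
Definition high_prefix u p :=
  (p < len u) &&
  [forall i : 'I_(len u), forall j : 'I_(len u),
     (i < p <= j) ==> (letter u j < letter u i)].

(** Minimal letters before [q] are exempt from the comparison, since every term of [v prec r] has
    them below the letters of [r]. *)
Definition low_suffix u q :=
  (q <= len u) &&
  [forall j : 'I_(len u), (q <= j) ==> (~~ ismin u j &&
     [forall i : 'I_(len u), (i < q) ==> ismin u i || (letter u j < letter u i)])].

Definition prime_word u :=
  [forall p : 'I_(len u), high_prefix u p ==> (p == 0 :> nat)] &&
  [forall q : 'I_(len u), ~~ low_suffix u q].

Lemma isminP u i :
  reflect (forall j, j < len u -> letter u i <= letter u j) (ismin u i).
Proof.
apply: (iffP forallP) => [h j ju|h j]; last exact: h.
exact: (h (Ordinal ju)).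
Qed.

Lemma high_prefixP u p :
  reflect (p < len u /\ forall i j, i < p -> p <= j -> j < len u ->
             letter u j < letter u i)
          (high_prefix u p).
Proof.
apply: (iffP andP) => -[pu h]; split=> //.
  move=> i j ip pj ju; have iu : i < len u by lia.
  move/forallP/(_ (Ordinal iu))/forallP/(_ (Ordinal ju))/implyP: h => /= -> //.
  by rewrite ip.
by apply/forallP => i; apply/forallP => j; apply/implyP => /andP[ip pj]; apply: h.
Qed.

Lemma low_suffixP u q :
  reflect (q <= len u /\ forall j, q <= j -> j < len u -> ~~ ismin u j /\
             forall i, i < q -> ismin u i \/ letter u j < letter u i)
          (low_suffix u q).
Proof.
apply: (iffP andP) => -[qu h]; split=> //.
  move=> j qj ju; have /implyP/(_ qj)/andP[nj hj] := forallP h (Ordinal ju).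
  split=> // i iq; have iu : i < len u by lia.
  by apply/orP; have /implyP := forallP hj (Ordinal iu); apply.
apply/forallP => j; apply/implyP => qj; have [-> hj] := h j qj (ltn_ord j).
by apply/forallP => i; apply/implyP => /hj; apply: (introT orP).
Qed.

Lemma prime_wordP u :
  reflect ((forall p, high_prefix u p -> p = 0) /\
           (forall q, low_suffix u q -> q = len u))
          (prime_word u).
Proof.
apply: (iffP andP) => -[hp hq]; split.
- move=> p up; have /high_prefixP[pu _] := up.
  by have /implyP/(_ up)/eqP := forallP hp (Ordinal pu).
- move=> q uq; have /low_suffixP[qu _] := uq.
  move: qu; rewrite leq_eqVlt => /orP[/eqP //|qu].
  by have := forallP hq (Ordinal qu); rewrite uq.
- by apply/forallP => p; apply/implyP => /hp ->.
- by apply/forallP => q; apply/negP => /hq qu; have := ltn_ord q; rewrite qu ltnn.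
Qed.

Lemma ex_min u : exists2 i, i < len u & ismin u i.
Proof.
have [x xu Ex] := smin_ex (len_gt0 u) (leqnn _).
exists x; first by case/andP: xu.
by apply/isminP => j ju; rewrite -Ex smin_le.
Qed.

Lemma high_prefix0 u : high_prefix u 0.
Proof. by apply/high_prefixP; split=> //; apply: len_gt0. Qed.

Lemma low_suffix_len u : low_suffix u (len u).
Proof. by apply/low_suffixP; split=> // j uj ju; lia. Qed.

(** A minimal letter cannot exceed the letter at [p], and a low suffix excludes minimal letters.
    Hence the core is nonempty and contains all the minima of [u]. *)
Lemma min_between u p q i :
  high_prefix u p -> low_suffix u q -> i < len u -> ismin u i -> p <= i < q.
Proof.
move=> /high_prefixP[pu hp] /low_suffixP[qu hq] iu mi; apply/andP; split.
  rewrite leqNgt; apply/negP => /hp /(_ (leqnn p) pu).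
  by have /isminP/(_ p pu) := mi; lia.
by rewrite ltnNge; apply/negP => /hq /(_ iu)[]; rewrite mi.
Qed.

Lemma high_prefix_lt u p q : high_prefix u p -> low_suffix u q -> p < q.
Proof.
move=> hp hq; have [i iu mi] := ex_min u.
by have /andP[] := min_between hp hq iu mi; lia.
Qed.

Section Core.
Variables (u : dpw) (a b : nat).
Hypotheses (ua : high_prefix u a) (ub : low_suffix u b).

Let ab : a < b. Proof. exact: high_prefix_lt ua ub. Qed.
Let bu : b <= len u. Proof. by have /low_suffixP[] := ub. Qed.
Let len_core : len (dsub a b u) = b - a. Proof. exact: len_dsub. Qed.

Lemma ismin_core i : i < b - a -> ismin (dsub a b u) i = ismin u (a + i).
Proof.
move=> iab; apply/isminP/isminP => h j; last first.
  by rewrite len_core => jab; rewrite letter_dsub //; apply: h; lia.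
have [m mu mm] := ex_min u; have abm := min_between ua ub mu mm.
move=> ju; apply: leq_trans _ (isminP _ _ mm _ ju).
have -> : m = a + (m - a) by lia.
by rewrite -(@letter_dsub a b) //; [apply: h; rewrite len_core; lia|lia].
Qed.

Lemma core_lt x y : x < b - a -> y < b - a ->
  (letter (dsub a b u) x < letter (dsub a b u) y) =
  (letter u (a + x) < letter u (a + y)).
Proof. by move=> xab yab; rewrite ltnNge letter_dsub // -ltnNge. Qed.

(** A nontrivial high prefix of the core would lengthen the prefix [a] of [u]. Together with
    [low_suffix_core] and the converses below, this makes the core prime exactly when [a] is the
    longest high prefix and [b] starts the longest low suffix. *)
Lemma high_prefix_core p : high_prefix (dsub a b u) p -> high_prefix u (a + p).
Proof.
case/high_prefixP; rewrite len_core => pab hp.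
have /high_prefixP[_ ha] := ua; have /low_suffixP[_ hb] := ub.
apply/high_prefixP; split=> [|i j iap apj ju]; first by lia.
have [ia|ai] := ltnP i a; first by apply: ha => //; lia.
have Ei : i = a + (i - a) by lia.
have ip : i - a < p by lia.
have [bj|jb] := leqP b j.
  (* The letter at [i] is above the one at [a + p], hence not minimal, so the suffix condition puts
     the letter at [j] below it. *)
  have [_ /(_ i)[]] := hb j bj ju => //; first by lia.
  move=> /isminP/(_ (a + p)) mi; have : letter u (a + p) < letter u i.
    by rewrite Ei -core_lt; [apply: hp; lia|lia|lia].
  by rewrite ltnNge mi //; lia.
have Ej : j = a + (j - a) by lia.
by rewrite Ei Ej -core_lt; [apply: hp; lia|lia|lia].
Qed.

Lemma low_suffix_core q : low_suffix (dsub a b u) q -> low_suffix u (a + q).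
Proof.
case/low_suffixP; rewrite len_core => qab hq.
have /high_prefixP[_ ha] := ua; have /low_suffixP[_ hb] := ub.
apply/low_suffixP; split=> [|j aqj ju]; first by lia.
have [bj|jb] := leqP b j.
  have [nj hj] := hb j bj ju; split=> // i iaq.
  by apply: hj; lia.
have Ej : j = a + (j - a) by lia.
have jab : j - a < b - a by lia.
have [|//|nj hj] := hq (j - a); first by lia.
split; first by rewrite Ej -ismin_core.
move=> i iaq; have [ia|ai] := ltnP i a; first by right; apply: ha => //; lia.
have Ei : i = a + (i - a) by lia.
have iab : i - a < b - a by lia.
by rewrite Ei Ej -core_lt // -ismin_core //; apply: hj; lia.
Qed.

Lemma core_high_prefix p :
  a <= p -> high_prefix u p -> high_prefix (dsub a b u) (p - a).
Proof.
move=> ap up; have pb := high_prefix_lt up ub; have /high_prefixP[_ hp] := up.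
apply/high_prefixP; rewrite len_core; split=> [|i j ipa paj jab]; first by lia.
by rewrite core_lt //; [apply: hp; lia|lia].
Qed.

Lemma core_low_suffix q :
  q <= b -> low_suffix u q -> low_suffix (dsub a b u) (q - a).
Proof.
move=> qb uq; have aq := high_prefix_lt ua uq; have /low_suffixP[_ hq] := uq.
apply/low_suffixP; rewrite len_core; split=> [|j qaj jab]; first by lia.
have [||nj hj] := hq (a + j); try by lia.
rewrite ismin_core //; split=> // i iqa.
by rewrite ismin_core ?core_lt //; [apply: hj; lia|lia|lia].
Qed.

End Core.

Fact ex_high_prefix u : exists p, high_prefix u p.
Proof. by exists 0; apply: high_prefix0. Qed.

Fact high_prefix_bound u p : high_prefix u p -> p <= len u.
Proof. by case/high_prefixP => /ltnW. Qed.

Fact ex_low_suffix u : exists q, low_suffix u q.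
Proof. by exists (len u); apply: low_suffix_len. Qed.

Definition cutl u := ex_maxn (ex_high_prefix u) (@high_prefix_bound u).
Definition cutr u := ex_minn (ex_low_suffix u).

Lemma cutl_prefix u : high_prefix u (cutl u).
Proof. by rewrite /cutl; case: ex_maxnP. Qed.

Lemma cutr_suffix u : low_suffix u (cutr u).
Proof. by rewrite /cutr; case: ex_minnP. Qed.

Lemma cutl_max u p : high_prefix u p -> p <= cutl u.
Proof. by rewrite /cutl; case: ex_maxnP => ? _; apply. Qed.

Lemma cutr_min u q : low_suffix u q -> cutr u <= q.
Proof. by rewrite /cutr; case: ex_minnP => ? _; apply. Qed.

Lemma cutl_lt_cutr u : cutl u < cutr u.
Proof. exact: high_prefix_lt (cutl_prefix u) (cutr_suffix u). Qed.

Lemma cutr_le u : cutr u <= len u.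
Proof. by have /low_suffixP[] := cutr_suffix u. Qed.

Lemma prime_core u : prime_word (dsub (cutl u) (cutr u) u).
Proof.
have ua := cutl_prefix u; have ub := cutr_suffix u.
have ab := cutl_lt_cutr u; have bu := cutr_le u.
apply/prime_wordP; split=> [p|q] v_pq.
  by have := cutl_max (high_prefix_core ua ub v_pq); lia.
have /low_suffixP[+ _] := v_pq; rewrite len_dsub //.
by have := cutr_min (low_suffix_core ua ub v_pq); lia.
Qed.

Lemma cut_unique u a b :
    high_prefix u a -> low_suffix u b -> prime_word (dsub a b u) ->
  cutl u = a /\ cutr u = b.
Proof.
move=> ua ub /prime_wordP[hp hq].
have ab := high_prefix_lt ua ub; have /low_suffixP[bu _] := ub.
split.
  have al := cutl_max ua.
  by have := hp _ (core_high_prefix ua ub al (cutl_prefix u)); lia.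
have rb := cutr_min ub.
have := hq _ (core_low_suffix ua ub rb (cutr_suffix u)).
by rewrite len_dsub //; have := high_prefix_lt ua (cutr_suffix u); lia.
Qed.

Definition odsub i j u : option dpw := if i < j then Some (dsub i j u) else None.
Definition olen (o : option dpw) := oapp len 0 o.

Definition cut u a b := (odsub 0 a u, dsub a b u, odsub b (len u) u).
Definition dec u := cut u (cutl u) (cutr u).

Lemma olen_odsub i j u : j <= len u -> olen (odsub i j u) = j - i.
Proof.
rewrite /odsub => ju; case: ltnP => [ij|ji] /=; first exact: len_dsub.
by apply/esym/eqP; rewrite subn_eq0.
Qed.

(* No letter 0 occurs in packed words, so sending the letter 1 of v to 0 puts *)
(* it below r, and the other letters of v fit between those of r and l.       *)
Section Graft.
Variables (l r : option dpw) (v : dpw).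
Hypothesis prime_v : prime_word v.

Let L := oapp dword [::] l.
Let R := oapp dword [::] r.
(** [N] exceeds all letters of [v] and [r]. In [s] the minima of [v] become 0, the letters of [r]
    stay in [1..N-1], the other letters of [v] fall strictly between [N] and [2 * N], and those of
    [l] are at least [2 * N]. *)
Let N := (\max_(x <- dword v ++ R) x).+1.
Let raise x := if x == 1 then 0 else N + x.
Let s := map (addn (2 * N)) L ++ map raise (dword v) ++ R.
Let d := oapp ddeco [::] l ++ ddeco v ++ oapp ddeco [::] r.
Let a := olen l.
Let b := olen l + len v.

Let size_L : size L = a. Proof. by rewrite /L /a; case: (l). Qed.
Let size_R : size R = olen r. Proof. by rewrite /R; case: (r). Qed.
Let size_s : size s = b + olen r.
Proof. by rewrite !size_cat !size_map size_L size_R addnA. Qed.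
Let ab : a < b. Proof. by rewrite /b -addn1 leq_add2l len_gt0. Qed.

Lemma packed_letter_gt0 w i : i < len w -> 0 < letter w i.
Proof.
move=> iw; have /packedP[m Em] := packed_dword w.
by have := mem_nth 0 iw; rewrite Em mem_iota => /andP[].
Qed.

Lemma ismin_letter w i : i < len w -> ismin w i = (letter w i == 1).
Proof.
move=> iw; apply/isminP/eqP => [h|-> j]; last exact: packed_letter_gt0.
have /packedP[m Em] := packed_dword w.
have m0 : 0 < m.
  by have := mem_nth 0 (len_gt0 w); rewrite Em mem_iota; lia.
have : 1 \in dword w by rewrite Em mem_iota; lia.
case/(nthP 0) => j jw Ej; apply/eqP; rewrite eqn_leq packed_letter_gt0 // andbT.
by rewrite -Ej; apply: h.
Qed.

Let nth_l i : i < a -> nth 0 s i = 2 * N + nth 0 L i.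
Proof.
by move=> ia; rewrite nth_cat size_map size_L ia (nth_map 0) // size_L.
Qed.

Let nth_v i : i < len v -> nth 0 s (a + i) = raise (letter v i).
Proof.
move=> iv; rewrite nth_cat size_map size_L ltnNge leq_addr /= addKn.
by rewrite nth_cat size_map iv (nth_map 0).
Qed.

Let nth_r i : nth 0 s (b + i) = nth 0 R i.
Proof.
rewrite /b -addnA nth_cat size_map size_L ltnNge leq_addr /= addKn.
by rewrite nth_cat size_map ltnNge leq_addr /= addKn.
Qed.

Let v_lt i : i < len v -> letter v i < N.
Proof.
by move=> iv; rewrite ltnS; apply: leq_bigmax_seq => //; rewrite mem_cat mem_nth.
Qed.

Let R_lt i : i < olen r -> 0 < nth 0 R i < N.
Proof.
rewrite -size_R => ir; apply/andP; split; last first.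
  rewrite ltnS; apply: leq_bigmax_seq => //.
  by rewrite mem_cat [X in _ || X]mem_nth ?orbT.
by move: ir; rewrite /R; case: (r) => //= w iw; apply: packed_letter_gt0.
Qed.

Let raise_le x y : x < N -> y < N -> 0 < x -> 0 < y ->
  (raise x <= raise y) = (x <= y).
Proof. by rewrite /raise; do !case: eqP; lia. Qed.

Let raise_lt x : x < N -> raise x < 2 * N.
Proof. by rewrite /raise; case: eqP; lia. Qed.

Definition graft_word : dpw := mkdpw v s d.
Let u := graft_word.

Let s_gt0 : 0 < size s. Proof. by rewrite size_s /b; have := len_gt0 v; lia. Qed.
Let size_d : size d = size s.
Proof.
rewrite size_s /d !size_cat size_ddeco /b.
by case: (l) (r) => [x|] [y|] /=; rewrite ?size_ddeco; lia.
Qed.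
Let d_gt0 : all (leq 1) d.
Proof.
rewrite /d !all_cat ddeco_gt0.
by case: (l) (r) => [x|] [y|] //=; rewrite ?ddeco_gt0.
Qed.

Let len_u : len u = b + olen r. Proof. by rewrite len_mkdpw. Qed.
Let ddeco_u : ddeco u = d. Proof. exact: ddeco_mkdpw. Qed.
Let letter_u i j : i < len u -> j < len u ->
  (letter u i <= letter u j) = (nth 0 s i <= nth 0 s j).
Proof. by rewrite len_u -size_s => iu ju; rewrite letter_mkdpw. Qed.
Let lt_u i j : i < len u -> j < len u ->
  (letter u i < letter u j) = (nth 0 s i < nth 0 s j).
Proof. by move=> iu ju; rewrite !ltnNge letter_u. Qed.

Let core_u : dsub a b u = v.
Proof.
have bu : b <= len u by rewrite len_u leq_addr.
have ba : b - a = len v by rewrite /b addKn.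
apply: dpw_inj; rewrite ?len_dsub ?ba //.
  move=> i j iv jv; rewrite letter_dsub ?ba // letter_u ?nth_v //; try by lia.
  by rewrite raise_le ?v_lt ?packed_letter_gt0.
have Eb : b = len v + a by rewrite addnC.
rewrite ddeco_dsub // ddeco_u /slice Eb -take_drop.
have -> : a = size (oapp ddeco [::] l).
  by rewrite /a; case: (l) => //= w; rewrite size_ddeco.
by rewrite drop_size_cat // -size_ddeco take_size_cat.
Qed.

Let left_u : odsub 0 a u = l.
Proof.
move: nth_l ddeco_u letter_u ab len_u; rewrite /odsub /d /L /a /b.
case: (l) => [x|] //= nl du lu axv lenu; rewrite len_gt0; congr Some.
have xu : len x <= len u by rewrite lenu; lia.
apply: dpw_inj; rewrite ?len_dsub ?len_gt0 ?subn0 //.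
  move=> i j ix jx; rewrite letter_dsub ?len_gt0 ?subn0 // lu; try by lia.
  by rewrite !nl // leq_add2l.
by rewrite ddeco_dsub ?len_gt0 // du /slice drop0 -size_ddeco take_size_cat.
Qed.

Let right_u : odsub b (len u) u = r.
Proof.
move: nth_r ddeco_u letter_u len_u; rewrite /odsub /d /R.
case: (r) => [x|] //= nr du lu lenu; last by rewrite lenu addn0 ltnn.
have x0 := len_gt0 x; have bu : b < len u by rewrite lenu; lia.
have Ex : len u - b = len x by rewrite lenu addKn.
have uu := leqnn (len u).
rewrite bu; congr Some; apply: dpw_inj; first by rewrite (len_dsub bu uu).
  move=> i j; rewrite (len_dsub bu uu) Ex => ix jx.
  by rewrite (letter_dsub bu uu) ?Ex // lu ?nr //; lia.
rewrite (ddeco_dsub bu uu) -size_ddeco /slice take_size du catA drop_size_cat //.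
rewrite size_cat size_ddeco /b.
by case: (l) => //= w; rewrite size_ddeco.
Qed.

Let prefix_u : high_prefix u a.
Proof.
apply/high_prefixP; split=> [|i j ia aj ju]; first by rewrite len_u; lia.
rewrite lt_u //; last by lia.
rewrite (nth_l ia); apply: (@leq_trans (2 * N)); last exact: leq_addr.
have [bj|jb] := leqP b j.
  have Ej : j = b + (j - b) by lia.
  have jr : j - b < olen r by move: ju; rewrite len_u; lia.
  by rewrite Ej nth_r; have := R_lt jr; lia.
have Ej : j = a + (j - a) by lia.
have jv : j - a < len v by move: jb; rewrite /b -/a; lia.
by rewrite Ej nth_v // raise_lt // v_lt.
Qed.

Let raise1 i : i < len v -> ismin v i -> raise (letter v i) = 0.
Proof. by move=> iv; rewrite ismin_letter // /raise => ->. Qed.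

Let suffix_u : low_suffix u b.
Proof.
have [m mv mm] := ex_min v.
apply/low_suffixP; split=> [|j bj ju]; first by rewrite len_u leq_addr.
have Ej : j = b + (j - b) by lia.
have jr : j - b < olen r by move: ju; rewrite len_u; lia.
have amu : a + m < len u by rewrite len_u /b; lia.
split=> [|i ib].
  apply/negP => /isminP/(_ _ amu); rewrite letter_u // nth_v // raise1 //.
  by rewrite {1}Ej nth_r; have := R_lt jr; lia.
have iu : i < len u by rewrite len_u; lia.
have [ia|ai] := ltnP i a.
  by right; move/high_prefixP: prefix_u => [_]; apply => //; lia.
have Ei : i = a + (i - a) by lia.
have iv : i - a < len v by move: ib; rewrite /b -/a; lia.
have [mi|ni] := boolP (ismin v (i - a)).
  by left; apply/isminP => t tu; rewrite letter_u // Ei nth_v // raise1.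
right; rewrite lt_u // {1}Ej {1}Ei nth_r nth_v // /raise -ismin_letter // (negPf ni).
by have := R_lt jr; lia.
Qed.

Lemma dec_graft_word : dec graft_word = (l, v, r).
Proof.
have prime_u : prime_word (dsub a b u) by rewrite core_u.
have [ul ur] := cut_unique prefix_u suffix_u prime_u.
by rewrite /dec -/u ul ur /cut left_u core_u right_u.
Qed.

End Graft.

End Decomposition.

(** * Leading terms *)

Section Leading.
Implicit Types (u v w : dpw) (a b : nat).
Local Open Scope nat_scope.

Definition inversions n w :=
  [set ij : 'I_n * 'I_n | (ij.1 < ij.2) && (letter w ij.2 < letter w ij.1)].

(** Lexicographic order on length and number of inversions, coded in one integer: there are at most
    [len w ^ 2] inversions, fewer than the gap between consecutive cubes. *)
Definition rank w := len w ^ 3 + #|inversions (len w) w|.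

Lemma rank_lt_len u w : len w < len u -> rank w < rank u.
Proof.
move=> wu; apply: leq_trans (leq_addr _ _).
have : #|inversions (len w) w| <= len w * len w.
  by apply: leq_trans (max_card _) _; rewrite card_prod card_ord.
have : (len w).+1 ^ 3 <= len u ^ 3 by rewrite leq_exp2r.
rewrite /rank !expnS !expn0; nia.
Qed.

Lemma odsub_eq i j u w : i <= j -> j <= len u -> j <= len w ->
    odsub i j u = odsub i j w ->
  (forall x y, i <= x < j -> i <= y < j ->
     (letter u x <= letter u y) = (letter w x <= letter w y)) /\
  slice i j (ddeco u) = slice i j (ddeco w).
Proof.
rewrite leq_eqVlt => /orP[/eqP-> ju jw _|ij ju jw].
  split=> [x y|]; first by lia.
  by rewrite /slice !drop_oversize // size_takel ?size_ddeco.
rewrite /odsub ij => -[Euw]; split=> [x y xij yij|].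
  have Ex : x = i + (x - i) by lia.
  have Ey : y = i + (y - i) by lia.
  have xji : x - i < j - i by lia.
  have yji : y - i < j - i by lia.
  by rewrite Ex Ey -(letter_dsub ij ju) // Euw letter_dsub.
by rewrite -!ddeco_dsub // Euw.
Qed.

(** The words occurring in [l succeq (v prec r)], each with coefficient 1 by [mcoeff_graft_base].
    The minimum of a term of [v prec r] is attained in [v], so [l] is compared with the zone of [v]
    alone. *)
Definition grafted w (t : option dpw * dpw * option dpw) :=
  let a := olen t.1.1 in let b := a + len t.1.2 in
  [&& len w == b + olen t.2, cut w a b == t,
      (a == 0) || (smin w a b <= smin w 0 a) &
      (b == len w) || (smin w a b < smin w b (len w))].

Lemma olen_cut u a b : a < b -> b <= len u ->
  [/\ olen (cut u a b).1.1 = a, len (cut u a b).1.2 = b - a &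
      olen (cut u a b).2 = len u - b].
Proof. by move=> ab bu; rewrite /= !olen_odsub ?len_dsub ?subn0 //; lia. Qed.

Section Dominance.
Variables (u : dpw) (a b : nat).
Hypotheses (ua : high_prefix u a) (ub : low_suffix u b).

Let ab : a < b. Proof. exact: high_prefix_lt ua ub. Qed.
Let bu : b <= len u. Proof. by have /low_suffixP[] := ub. Qed.

Lemma grafted_cut w :
  grafted w (cut u a b) =
  [&& len w == len u, cut w a b == cut u a b,
      (a == 0) || (smin w a b <= smin w 0 a) &
      (b == len w) || (smin w a b < smin w b (len w))].
Proof.
have [/= El Ev Er] := olen_cut ab bu.
by rewrite /grafted /= El Ev Er !(subnKC (ltnW ab)) subnKC.
Qed.

Lemma grafted_self : grafted u (cut u a b).
Proof.
rewrite grafted_cut !eqxx /=; have [m mu mm] := ex_min u.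
have abm := min_between ua ub mu mm.
have mab : smin u a b <= letter u m by apply: smin_le.
apply/andP; split.
  case: posnP => //= a0; have au : a <= len u by lia.
  have [x xa ->] := smin_ex a0 au; apply: leq_trans mab _.
  by apply: (isminP _ _ mm); lia.
have [//|nbu /=] := eqVneq b (len u); have blt : b < len u by lia.
have [x xb ->] := smin_ex blt (leqnn _); apply: leq_ltn_trans mab _.
have /low_suffixP[_ hb] := ub; have [||nx _] := hb x; try by lia.
rewrite ltnNge; apply: contra nx => xm; apply/isminP => j ju.
exact: leq_trans xm (isminP _ _ mm _ ju).
Qed.

Variable w : dpw.
Hypothesis w_graft : grafted w (cut u a b).

Let len_w : len w = len u.
Proof. by move: w_graft; rewrite grafted_cut => /andP[/eqP]. Qed.
Let bw : b <= len w. Proof. by rewrite len_w. Qed.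

Let same_cut :
  (forall x y,
     [|| (x < a) && (y < a), (a <= x < b) && (a <= y < b)
       | (b <= x < len u) && (b <= y < len u)] ->
     (letter u x <= letter u y) = (letter w x <= letter w y)) /\
  ddeco w = ddeco u.
Proof.
move: w_graft; rewrite grafted_cut => /and4P[_ /eqP[El Ev Er] _ _].
have au := leq_trans (ltnW ab) bu; have aw := leq_trans (ltnW ab) bw.
have wu : len u <= len w by rewrite len_w.
have Ec : odsub a b u = odsub a b w by rewrite /odsub Ev.
have {}Er : odsub b (len u) u = odsub b (len u) w by rewrite -Er len_w.
have [l_le l_deco] := odsub_eq (leq0n a) au aw (esym El).
have [c_le c_deco] := odsub_eq (ltnW ab) bu bw Ec.
have [r_le r_deco] := odsub_eq bu (leqnn _) wu Er.
split=> [x y|].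
  by case/or3P => /andP[hx hy]; [apply: l_le|apply: c_le|apply: r_le].
have sliceE (s : seq nat) : size s = len u ->
    s = slice 0 a s ++ slice a b s ++ slice b (len u) s.
  move=> sz; rewrite {3}/slice -sz take_size /slice drop0.
  rewrite -{1}(cat_take_drop a s) -{1}(cat_take_drop (b - a) (drop a s)).
  by rewrite drop_drop take_drop !subnK // ltnW.
rewrite [LHS]sliceE ?size_ddeco // [RHS]sliceE ?size_ddeco //.
by rewrite l_deco c_deco r_deco.
Qed.

Let same_zone := proj1 same_cut.

Let min_lt_right x y : ismin u x -> a <= x < b -> b <= y < len u ->
  letter w x < letter w y.
Proof.
move=> mx abx byu; have blt : b < len u by lia.
have wx : letter w x <= smin w a b.
  have [z zab ->] := smin_ex ab bw; rewrite -same_zone; last by rewrite abx zab orbT.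
  by apply: (isminP _ _ mx); lia.
move: w_graft; rewrite grafted_cut => /and4P[_ _ _ /orP[/eqP|mlt]]; first by lia.
apply: leq_ltn_trans wx _; apply: leq_trans mlt _; apply: smin_le => //; lia.
Qed.

(** Two positions in different zones are inverted in [u], unless the left one carries a minimum of
    the core and the right one lies in the suffix; in that case the strict order is forced in [w]
    too. *)
Let cross x y : x < y -> y < len u ->
  [|| (x < a) && (y < a), (a <= x < b) && (a <= y < b)
      | (b <= x < len u) && (b <= y < len u)] \/
  letter u y < letter u x \/
  (letter u x < letter u y /\ letter w x < letter w y).
Proof.
move=> xy yu; have /high_prefixP[_ ha] := ua; have /low_suffixP[_ hb] := ub.
have [xa|ax] := ltnP x a.
  have [ya|ay] := ltnP y a; first by left.
  by right; left; apply: ha.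
have [xb|bx] := ltnP x b; last by left; lia.
have [yb|b_y] := ltnP y b; first by left; lia.
have [ny hy] := hb y b_y yu.
case: (hy x xb) => [mx|]; last by right; left.
right; right; split; last by apply: min_lt_right => //; lia.
rewrite ltnNge; apply: contra ny => yx; apply/isminP => j ju.
exact: leq_trans yx (isminP _ _ mx _ ju).
Qed.

Lemma inversions_grafted : inversions (len u) w \subset inversions (len u) u.
Proof.
apply/subsetP => -[i j]; rewrite !inE /= => /andP[ij wji]; rewrite ij /=.
have [z|[//|[_ wij]]] := cross ij (ltn_ord j); last by lia.
by rewrite ltnNge same_zone // -ltnNge.
Qed.

(** Inversions alone do not detect equal letters. Inside a zone the order is prescribed, and by
    [cross] two letters from different zones are never equal, in [u] or in [w], so nothing is
    lost. *)
Lemma inversions_grafted_eq :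
  inversions (len u) w = inversions (len u) u -> w = u.
Proof.
move=> Einv; have inv_eq i j : i < j -> j < len u ->
    (letter w j < letter w i) = (letter u j < letter u i).
  move=> ij ju; have iu := ltn_trans ij ju.
  move/setP/(_ (Ordinal iu, Ordinal ju)): Einv.
  by rewrite !inE /= ij.
apply: dpw_inj => [//|i j|]; last exact: (proj2 same_cut).
rewrite len_w => iu ju.
have [ij|ji|->] := ltngtP i j; last by rewrite !leqnn.
  by rewrite leqNgt inv_eq // -leqNgt.
have [z|[uij|[uji wji]]] := cross ji iu.
- by rewrite same_zone //; case/or3P: z => /andP[-> ->]; rewrite ?orbT.
- have wij : letter w i < letter w j by rewrite inv_eq.
  by rewrite (ltnW uij) (ltnW wij).
- by rewrite [LHS]leqNgt [RHS]leqNgt uji wji.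
Qed.

Lemma rank_grafted : w != u -> rank w < rank u.
Proof.
move=> nwu; rewrite /rank len_w ltn_add2l; apply: proper_card.
rewrite properEneq inversions_grafted andbT.
by apply: contra nwu => /eqP /inversions_grafted_eq ->.
Qed.

End Dominance.

End Leading.

(** * Freeness for [qsh_prec] and [qsh_succeq] *)

Section FreePrecSucceq.
Variable k : fieldType.
Implicit Types (x y z : QShd k) (a b w : dpw) (c d : rel nat).

Lemma mcoeff_qsh_basel c a y w :
  (qsh_prod c << a >> y)@_w =
  [&& (len a < len w)%N, c (smin w 0 (len a)) (smin w (len a) (len w)) &
      dsub 0 (len a) w == a]%:R * y@_(dsub (len a) (len w) w).
Proof.
rewrite mcoeff_qsh_prod; have [aw|wa] /= := ltnP (len a) (len w); last first.
  rewrite mul0r big_nat big1 // => p pw; rewrite mcoeff_base.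
  case: eqP => [ap|]; last by rewrite mul0r mulr0.
  by move: wa; rewrite ap len_dsub //; lia.
rewrite (bigD1_seq (len a)) ?iota_uniq ?mem_index_iota ?len_gt0 //=.
rewrite big_nat_cond big1 ?addr0 => [|p /andP[/andP[p0 pw] pa]].
  by rewrite mcoeff_base eq_sym mulrA -natrM mulnb.
rewrite mcoeff_base; case: eqP => [ap|]; last by rewrite mul0r mulr0.
by case/eqP: pa; rewrite ap len_dsub // ?subn0 // ltnW.
Qed.

Lemma qsh_succeqE x y : qsh_succeq x y = qsh_prod geq x y.
Proof.
apply/malgP => w; rewrite mcoeffD !mcoeff_qsh_prod -big_split.
apply: eq_bigr => p _ /=; rewrite -mulrDl -natrD; congr (_%:R * _).
by rewrite [LHS]/=; case: ltngtP.
Qed.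

Lemma qsh_starE x y :
  qsh_prec x y + qsh_succeq x y = qsh_prod (fun _ _ => true) x y.
Proof.
apply/malgP => w; rewrite qsh_succeqE mcoeffD !mcoeff_qsh_prod -big_split.
apply: eq_bigr => p _ /=; rewrite -mulrDl -natrD; congr (_%:R * _).
by rewrite [LHS]/=; case: ltnP.
Qed.

(** All the products involved are [qsh_prod] of a relation, the star product being that of the
    always true relation, so each axiom is an instance of [qsh_prodA]. *)
Lemma prec_succeq_NSh : is_NSh (@qsh_prec k) (@qsh_succeq k).
Proof.
have inv_lt : order_invariant ltn.
  by move=> i j i' j' _ ji; rewrite /= !ltnNge ji.
have inv_ge : order_invariant geq by move=> i j i' j' _ ji.
have inv_T : order_invariant (fun _ _ => true) by [].
split.
- by split=> z; [apply: qsh_prod_linl|apply: qsh_prod_linr].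
- split=> z a x y; rewrite !qsh_succeqE; first exact: qsh_prod_linl.
  exact: qsh_prod_linr.
- move=> x y z; rewrite qsh_starE; apply: qsh_prodA => // i j l /=; lia.
- move=> x y z; rewrite !qsh_succeqE; apply: qsh_prodA => // i j l /=; lia.
- move=> x y z; rewrite qsh_starE !qsh_succeqE.
  by apply: qsh_prodA => // i j l /=; lia.
Qed.

Lemma mcoeff_graft_base l v r w :
  (graft_base (@qsh_prec k) (@qsh_succeq k) (l, v, r))@_w =
  (grafted w (l, v, r))%:R.
Proof.
pose vr := if r is Some y then qsh_prec (<< v >> : QShd k) << y >> else << v >>.
have vrE w' : vr@_w' = [&& len w' == len v + olen r, dsub 0 (len v) w' == v,
    odsub (len v) (len w') w' == r &
    (len v == len w') || (smin w' 0 (len v) < smin w' (len v) (len w'))]%N%:R.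
  rewrite /vr; case: (r) => [y|] /=; last first.
    rewrite mcoeff_base addn0; congr (_%:R : k); congr nat_of_bool.
    have [<-|nvw] := eqVneq v w'.
      by rewrite dsub_full !eqxx /odsub ltnn.
    case: eqP => //= lw; rewrite -lw dsub_full eq_sym (negPf nvw).
    by [].
  rewrite mcoeff_qsh_base mem_qshufflesE; have y0 := len_gt0 y.
  congr (_%:R : k); congr nat_of_bool; case: eqP => //= lw.
  have vw : (len v < len w')%N by lia.
  rewrite /odsub vw (inj_eq (@Some_inj _)) (ltn_eqF vw) /=.
  by rewrite andbC -andbA.
have v0 := len_gt0 v.
have -> : graft_base (@qsh_prec k) (@qsh_succeq k) (l, v, r) =
          if l is Some x then qsh_succeq << x >> vr else vr.
  by rewrite /vr; case: (l) (r) => [x|] [y|].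
rewrite /grafted /cut /=.
case: l => [x|] /=; last first.
  rewrite vrE !add0n; congr (_%:R : k); congr nat_of_bool.
  case: eqP => //= lw; rewrite !xpair_eqE.
  have -> : odsub 0 0 w = None by []; rewrite eqxx /=.
  by rewrite -!andbA.
have x0 := len_gt0 x; rewrite qsh_succeqE mcoeff_qsh_basel vrE -natrM mulnb.
congr (_%:R : k); congr nat_of_bool.
have [lw|nlw] /= := eqVneq (len w) (len x + len v + olen r)%N; last first.
  have [xw|] //= := ltnP (len x) (len w); rewrite len_dsub //.
  by case: (_ - _ =P _)%N => [lw|]; rewrite ?andbF //; case/eqP: nlw; lia.
have xw : (len x < len w)%N by lia.
have Ew : (len x + (len w - len x) = len w)%N by lia.
have Eo : odsub (len v) (len w - len x) (dsub (len x) (len w) w) =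
          odsub (len x + len v) (len w) w.
  rewrite /odsub.
  have -> : (len v < len w - len x)%N = (len x + len v < len w)%N by lia.
  by case: ifP => // vxw; rewrite dsub_dsub //; [rewrite Ew|lia].
rewrite len_dsub // Eo dsub_dsub ?addn0 //; last by lia.
rewrite !xpair_eqE.
have -> : odsub 0 (len x) w = Some (dsub 0 (len x) w) by rewrite /odsub x0.
rewrite (inj_eq (@Some_inj _)).
rewrite xw (_ : (len w - len x == len v + olen r)%N); last by lia.
rewrite (_ : (len x == 0)%N = false) /=; last by lia.
have Ev : (len v == len w - len x)%N = (len x + len v == len w)%N by lia.
rewrite Ev.
case: (dsub 0 (len x) w == x); rewrite ?andbF //= andbT.
case: (_ == v); rewrite ?andbF //=; case: (_ == r); rewrite ?andbF //=.
have [El|nEl] /= := eqVneq (len x + len v)%N (len w).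
  by rewrite El !andbT.
have xvw : (len x + len v < len w)%N by lia.
rewrite ltnNge smin_dsub_le ?addn0 ?Ew; try by lia.
(* The outer product sees the minimum of the joined zones of [v] and [r], which is that of [v] once
   [v] is below [r]. *)
rewrite -ltnNge (@smin_cat w (len x) (len x + len v)) //; last by lia.
lia.
Qed.

Lemma tail_rank u w :
  w \in msupp (graft_tail (@qsh_prec k) (@qsh_succeq k) dec u) ->
  (rank w < rank u)%N.
Proof.
have hp := cutl_prefix u; have hs := cutr_suffix u.
rewrite -mcoeff_neq0 mcoeffB mcoeff_base mcoeff_graft_base.
have [<-|nuw] := eqVneq u w.
  by rewrite (grafted_self hp hs) subrr eqxx.
rewrite subr0; case gw: grafted; rewrite ?eqxx // => _.
by apply: (rank_grafted hp hs); rewrite // eq_sym.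
Qed.

Lemma prec_succeq_free : free_NSh (@qsh_prec k) (@qsh_succeq k).
Proof.
apply: (@graft_triangular_free k dpw _ _ _ prime_word rank dec).
- exact: prec_succeq_NSh.
- exact: prime_core.
- by move=> l v r pv; exists (graft_word l r v); apply: dec_graft_word.
- move=> u l; rewrite /= /odsub; case: ifP => // a0 [<-].
  have := cutl_lt_cutr u; have := cutr_le u => bu ab.
  by apply: rank_lt_len; rewrite len_dsub //; lia.
- move=> u r; rewrite /= /odsub; case: ifP => // bu [<-].
  have ab := cutl_lt_cutr u.
  by apply: rank_lt_len; rewrite len_dsub //; lia.
- exact: tail_rank.
Qed.

End FreePrecSucceq.

(** * Reversal *)

Section Opposite.
Variables (k : fieldType).

Lemma opp_NSh (A : lmodType k) (prec succ : A -> A -> A) :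
  is_NSh prec succ -> is_NSh (fun x y => succ y x) (fun x y => prec y x).
Proof.
case=> -[pl pr] [sl sr] ps sp ss; split=> //.
- by move=> x y z; rewrite addrC ss.
- by move=> x y z; rewrite addrC ps.
Qed.

Lemma opp_NSh_morphism (A B : lmodType k) (pA sA : A -> A -> A)
    (pB sB : B -> B -> B) (f : A -> B) :
  NSh_morphism pA sA (fun x y => sB y x) (fun x y => pB y x) f ->
  NSh_morphism (fun x y => sA y x) (fun x y => pA y x) pB sB f.
Proof. by case=> f_lin fp fs; split=> // x y; rewrite ?fs ?fp. Qed.

(** Taking opposites is an involution, so the universal property is tested against the opposite of
    the target. *)
Lemma opp_free_NSh_on (V F : lmodType k) (prec succ : F -> F -> F) (i : V -> F) :
  free_NSh_on prec succ i ->
  free_NSh_on (fun x y => succ y x) (fun x y => prec y x) i.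
Proof.
case=> F_NSh i_lin univ; split=> // [|B pB sB f B_NSh f_lin].
  exact: opp_NSh.
have [g [g_mor g_i g_uniq]] := univ _ _ _ _ (opp_NSh B_NSh) f_lin.
exists g; split=> // [|g' g'_mor]; first exact: opp_NSh_morphism.
apply: g_uniq; move: g'_mor.
exact: (@opp_NSh_morphism _ _ _ _ (fun x y => sB y x) (fun x y => pB y x)).
Qed.

(** Composing with [rho] turns an isomorphism from [F] onto [A] into one from the opposite of [F],
    free on the same space, onto [B]. *)
Lemma free_NSh_antimorphism (A B : lmodType k) (pA sA : A -> A -> A)
    (pB sB : B -> B -> B) (rho : A -> B) :
    linear rho -> bijective rho ->
    (forall x y, rho (pA x y) = sB (rho y) (rho x)) ->
    (forall x y, rho (sA x y) = pB (rho y) (rho x)) ->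
  free_NSh pA sA -> free_NSh pB sB.
Proof.
move=> rho_lin rho_bij rho_p rho_s [A_NSh [V [F [pF [sF [i [F_free]]]]]]].
case=> phi [phi_lin phi_p phi_s] phi_bij; split; last first.
  exists V, F, (fun x y => sF y x), (fun x y => pF y x), i.
  split; first exact: opp_free_NSh_on.
  exists (rho \o phi); last exact: bij_comp.
  split=> [a x y|x y|x y] /=; first by rewrite phi_lin rho_lin.
  - by rewrite phi_s rho_s.
  - by rewrite phi_p rho_p.
have [sigma rhoK sigmaK] := rho_bij.
have rho_onto y : exists x, y = rho x by exists (sigma y).
have rhoD := linear_funD rho_lin.
(* The axioms of [B] are pulled back along the surjection [rho], which exchanges left with right and
   [prec] with [succ]. *)
case: A_NSh => -[pl pr] [sl sr] ps sp ss; split.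
- split=> z0 a x0 y0; case: (rho_onto z0) (rho_onto x0) (rho_onto y0).
  + move=> z -> [x ->] [y ->]; rewrite -rho_lin -!rho_s.
    by rewrite -rho_lin; congr rho; apply: sr.
  + move=> z -> [x ->] [y ->]; rewrite -rho_lin -!rho_s.
    by rewrite -rho_lin; congr rho; apply: sl.
- split=> z0 a x0 y0; case: (rho_onto z0) (rho_onto x0) (rho_onto y0).
  + move=> z -> [x ->] [y ->]; rewrite -rho_lin -!rho_p.
    by rewrite -rho_lin; congr rho; apply: pr.
  + move=> z -> [x ->] [y ->]; rewrite -rho_lin -!rho_p.
    by rewrite -rho_lin; congr rho; apply: pl.
- move=> x0 y0 z0; case: (rho_onto z0) (rho_onto x0) (rho_onto y0).
  by move=> z -> [x ->] [y ->]; rewrite -!(rho_s, rho_p) -rhoD -rho_s addrC ss.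
- move=> x0 y0 z0; case: (rho_onto z0) (rho_onto x0) (rho_onto y0).
  by move=> z -> [x ->] [y ->]; rewrite -!(rho_s, rho_p) sp.
- move=> x0 y0 z0; case: (rho_onto z0) (rho_onto x0) (rho_onto y0).
  by move=> z -> [x ->] [y ->]; rewrite -!(rho_s, rho_p) -rhoD -rho_p addrC ps.
Qed.

End Opposite.

Section Reversal.
Implicit Types (u v w : dpw).
Local Open Scope nat_scope.

Definition revw w : dpw := mkdpw w (rev (dword w)) (rev (ddeco w)).

Let rev_gt0 w : 0 < size (rev (dword w)).
Proof. by rewrite size_rev; apply: len_gt0. Qed.
Let size_rev_deco w : size (rev (ddeco w)) = size (rev (dword w)).
Proof. by rewrite !size_rev size_ddeco. Qed.
Let rev_deco_gt0 w : all (leq 1) (rev (ddeco w)).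
Proof. by rewrite all_rev ddeco_gt0. Qed.

Lemma ddeco_revw w : ddeco (revw w) = rev (ddeco w).
Proof. exact: ddeco_mkdpw. Qed.

Lemma dword_revw w : dword (revw w) = rev (dword w).
Proof.
rewrite dword_mkdpw //; apply: pack_id; apply/packedP.
by have /packedP[m Em] := packed_dword w; exists m => x; rewrite mem_rev.
Qed.

Lemma len_revw w : len (revw w) = len w.
Proof. by rewrite /len dword_revw size_rev. Qed.

Lemma letter_revw w i : i < len w -> letter (revw w) i = letter w (len w - i.+1).
Proof. by move=> iw; rewrite /letter dword_revw nth_rev. Qed.

Lemma revwK : involutive revw.
Proof.
move=> w; apply: dpw_inj; rewrite ?len_revw //; last by rewrite !ddeco_revw revK.
by move=> i j iw jw; rewrite /letter !dword_revw revK.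
Qed.

Lemma slice_rev i j (s : seq nat) : i <= j -> j <= size s ->
  slice i j (rev s) = rev (slice (size s - j) (size s - i) s).
Proof.
move=> ij js; rewrite /slice take_rev drop_rev size_drop take_drop.
by congr (rev (drop _ (take _ _))); lia.
Qed.

Lemma minl_rev (s : seq nat) : minl (rev s) = minl s.
Proof.
case: s => // x t; set s := x :: t; have s0 : 0 < size s by [].
apply/eqP; rewrite eqn_leq !minl_le //.
  by rewrite -mem_rev minl_mem // size_rev.
by rewrite mem_rev minl_mem.
Qed.

Lemma smin_revw w i j : i <= j -> j <= len w ->
  smin (revw w) i j = smin w (len w - j) (len w - i).
Proof. by move=> ij jw; rewrite /smin dword_revw slice_rev // minl_rev. Qed.

Lemma dsub_revw w i j : i < j -> j <= len w ->
  dsub i j (revw w) = revw (dsub (len w - j) (len w - i) w).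
Proof.
move=> ij jw; have ji : len w - j < len w - i by lia.
have iw : len w - i <= len w by lia.
have jw' : j <= len (revw w) by rewrite len_revw.
have lenE : len (dsub (len w - j) (len w - i) w) = j - i by rewrite len_dsub //; lia.
apply: dpw_inj.
- by rewrite (len_dsub ij jw') len_revw lenE.
- move=> x y; rewrite (len_dsub ij jw') => xij yij.
  rewrite (letter_dsub ij jw') // !letter_revw ?lenE //; try by lia.
  rewrite (letter_dsub ji iw) //; try by lia.
  by congr (letter _ _ <= letter _ _); lia.
- rewrite (ddeco_dsub ij jw') !ddeco_revw (ddeco_dsub ji iw).
  by rewrite slice_rev ?size_ddeco // ltnW.
Qed.

End Reversal.

(** * Freeness for [qsh_preceq] and [qsh_succ] by reversal *)

Section MainTheorem.
Variable k : fieldType.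
Implicit Types (x y : QShd k).

Definition revq : QShd k -> QShd k := malg_ext (fun w => << revw w >>).

Lemma mcoeff_revq x w : (revq x)@_w = x@_(revw w).
Proof.
rewrite /revq /malg_ext raddf_sum -sum_mcoeff_eq; apply: eq_bigr => b _ /=.
by rewrite mcoeffZ mcoeff_base (can2_eq revwK revwK).
Qed.

Lemma revqK : involutive revq.
Proof. by move=> x; apply/malgP => w; rewrite !mcoeff_revq revwK. Qed.

(** The cut [p] of a word corresponds to the cut [len w - p] of its reverse, with the two factors
    reversed and exchanged, so their minima are compared in the opposite order. *)
Lemma revq_prod (c : rel nat) x y :
  revq (qsh_prod c x y) = qsh_prod (fun i j => c j i) (revq y) (revq x).
Proof.
apply/malgP => w; rewrite mcoeff_revq !mcoeff_qsh_prod len_revw big_nat_rev.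
apply: eq_big_nat => p /andP[p0 pw]; rewrite add1n subSS !mcoeff_revq.
have pn : (len w - p <= len w)%N by exact: leq_subr.
have np : (len w - p < len w)%N by lia.
have np0 : (0 < len w - p)%N by lia.
rewrite !smin_revw ?dsub_revw // ?subnn ?subn0 ?subKn ?(ltnW pw) //.
by rewrite [x@__ * _]mulrC.
Qed.

Lemma preceq_succ_free : free_NSh (@qsh_preceq k) (@qsh_succ k).
Proof.
apply: (free_NSh_antimorphism (rho := revq) _ _ _ _ (prec_succeq_free k)).
- exact: malg_ext_linear.
- by exists revq; apply: revqK.
- by move=> x y; apply: revq_prod.
- move=> x y; rewrite /qsh_succeq linear_funD; last exact: malg_ext_linear.
  congr (_ + _); first exact: revq_prod.
  (* Equality of minima is symmetric, so reversal sends the bullet product to its opposite. *)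
  rewrite [LHS]revq_prod; apply/malgP => w; rewrite !mcoeff_qsh_prod.
  by apply: eq_bigr => p _; rewrite /= eq_sym.
Qed.

End MainTheorem.

Theorem mainTheorem12 (k : fieldType) :
  free_NSh (@qsh_preceq k) (@qsh_succ k) /\
  free_NSh (@qsh_prec k) (@qsh_succeq k).
Proof. by split; [apply: preceq_succ_free|apply: prec_succeq_free]. Qed.
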